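(* Let $R$ be a non-discrete irreducible, continuous ring and let $K = \mathrm{Z}(R)$. An element of $R$ is algebraic over $K$ if and only if it is matricial in $R$.
   Context: Rings are associative; for a unital ring $R$, $\mathrm{Z}(R)$ is its center and $\mathrm{E}(R)=\{e\in R\mid e^2=e\}$. A unital ring $R$ is (von Neumann) regular if for every $a\in R$ there is $b\in R$ with $aba=a$; then the set $\mathrm{L}(R)=\{aR\mid a\in R\}$ of principal right ideals, ordered by inclusion, is a complemented modular lattice. A continuous geometry is a complete, complemented, modular lattice $L$ such that for every chain $C\subseteq L$ and $x\in L$: $x\wedge\bigvee C=\bigvee\{x\wedge y\mid y\in C\}$ and $x\vee\bigwedge C=\bigwedge\{x\vee y\mid y\in C\}$. A continuous ring is a regular ring $R$ such that $\mathrm{L}(R)$ is a continuous geometry. A ring is irreducible if it is non-zero and not isomorphic to a direct product of two non-zero rings; for regular $R$ this is equivalent to $\mathrm{Z}(R)$ being a field, and $R$ is then viewed as a unital $\mathrm{Z}(R)$-algebra. A rank function on a regular ring $R$ is a map $\rho\colon R\to[0,1]$ with $\rho(1)=1$, $\rho(ab)\le\min\{\rho(a),\rho(b)\}$ for all $a,b\in R$, $\rho(e+f)=\rho(e)+\rho(f)$ for $e,f\in\mathrm{E}(R)$ with $ef=fe=0$, and $\rho(a)>0$ for $a\ne 0$. Every irreducible, continuous ring $R$ has a unique rank function $\mathrm{rk}_R$, and $d_R(a,b)=\mathrm{rk}_R(a-b)$ is a complete metric on $R$; $R$ is non-discrete if the topology of $d_R$ is not discrete. An element $a$ of a unital $K$-algebra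 ($K$ a field) is algebraic over $K$ if $p(a)=0$ for some non-zero $p\in K[X]$. A $K$-algebra is matricial if it is isomorphic, as a $K$-algebra, to $\prod_{i=1}^m\mathrm{M}_{n_i}(K)$ for some $m\ge1$ and $n_1,\dots,n_m\ge1$. An element of an irreducible, regular ring $R$ is matricial (in $R$) if it is contained in some unital $\mathrm{Z}(R)$-subalgebra of $R$ (with the same unit as $R$) that is a matricial $\mathrm{Z}(R)$-algebra. *)

(* Defs.v *)
From HB Require Import structures.
From mathcomp Require Import all_boot all_order all_algebra.
From mathcomp Require Import all_classical.
From mathcomp Require Import reals.

Set Implicit Arguments.
Unset Strict Implicit.
Unset Printing Implicit Defensive.

Import Order.TTheory GRing.Theory Num.Theory.

Local Open Scope classical_set_scope.
Local Open Scope ring_scope.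

(* Joins and meets are taken through the relations [supremums] and [infimums]
   (which contain at most one element each), so that the notion makes sense for
   a bare partial order: that the latter is a lattice is part of
   [cg_complete]. *)
Record continuous_geometry (d : Order.disp_t) (L : porderType d) : Prop := {
  cg_complete : forall A : set L,
    (exists s, supremums A s) /\ (exists i, infimums A i);
  (* [supremums setT] and [infimums setT] are the singletons of the top and of
     the bottom element *)
  cg_complemented : forall x : L, exists y : L,
    supremums [set x; y] = supremums [set: L] /\
    infimums [set x; y] = infimums [set: L];
  (* x <= z implies x \/ (y /\ z) = (x \/ y) /\ z *)
  cg_modular : forall x y z yz xy s : L, (x <= z)%O ->
    infimums [set y; z] yz -> supremums [set x; yz] s ->
    supremums [set x; y] xy -> infimums [set xy; z] s;
  cg_meet_continuous : forall (C : set L) (x c m : L),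
    total_on C (fun u v => (u <= v)%O) ->
    supremums C c -> infimums [set x; c] m ->
    supremums [set w | exists2 y, C y & infimums [set x; y] w] m;
  cg_join_continuous : forall (C : set L) (x c j : L),
    total_on C (fun u v => (u <= v)%O) ->
    infimums C c -> supremums [set x; c] j ->
    infimums [set w | exists2 y, C y & supremums [set x; y] w] j
}.

Definition regular_ring (R : nzRingType) : Prop :=
  forall a : R, exists b : R, a * b * a = a.

Definition right_principal (R : nzRingType) (a : R) : set R :=
  [set a * x | x in [set: R]].

Definition is_right_principal (R : nzRingType) : pred (set R) :=
  fun I => `[< exists a : R, I = right_principal a >].

Record right_principal_ideals (R : nzRingType) := RightPrincipalIdeal {
  ideal_set :> set R;
  _ : is_right_principal ideal_set
}.

Section RightPrincipalIdealsOrder.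
Variable R : nzRingType.
Local Notation L := (right_principal_ideals R).
HB.instance Definition _ := [isSub for @ideal_set R].
HB.instance Definition _ := [Choice of L by <:].
(* the inclusion order, inherited from [set R] *)
HB.instance Definition _ :=
  [SubChoice_isSubPOrder of L by <: with set_display].
End RightPrincipalIdealsOrder.

Definition continuous_ring (R : nzRingType) : Prop :=
  regular_ring R /\ continuous_geometry (right_principal_ideals R).

(* Non-zeroness is carried by [nzRingType], for R as well as for the two
   factors. *)
Definition irreducible_ring (R : nzRingType) : Prop :=
  ~ exists (R1 R2 : nzRingType) (f : {rmorphism R -> (R1 * R2)%type}),
      bijective f.

Record rank_function (F : realType) (R : nzRingType) (rho : R -> F) : Prop := {
  rank_itv : forall a, 0 <= rho a <= 1;
  rank1 : rho 1 = 1;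
  rankM : forall a b, rho (a * b) <= Num.min (rho a) (rho b);
  rankD : forall e f, e * e = e -> f * f = f -> e * f = 0 -> f * e = 0 ->
    rho (e + f) = rho e + rho f;
  rank_gt0 : forall a, a != 0 -> 0 < rho a
}.

Definition metric_open (F : realType) (T : Type) (dist : T -> T -> F)
    (U : set T) : Prop :=
  forall x, U x -> exists2 e : F, 0 < e & [set y | dist x y < e] `<=` U.

(* The rank function of an irreducible continuous ring exists and is unique;
   here it is bound existentially. *)
Definition nondiscrete_ring (F : realType) (R : nzRingType) : Prop :=
  exists2 rk : R -> F, rank_function rk &
    ~ forall U : set R, metric_open (fun a b => rk (a - b)) U.

Definition in_center (R : nzRingType) : {pred R} :=
  fun z => `[< forall x : R, z * x = x * z >].

Section Center.
Variable R : nzRingType.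

Lemma in_centerP (z : R) :
  reflect (forall x : R, z * x = x * z) (z \in @in_center R).
Proof. exact: asboolP. Qed.

Lemma center_subring_closed : subring_closed (@in_center R).
Proof.
split.
- by apply/in_centerP => x; rewrite mul1r mulr1.
- move=> u v /in_centerP hu /in_centerP hv; apply/in_centerP => x.
  by rewrite mulrBl mulrBr hu hv.
- move=> u v /in_centerP hu /in_centerP hv; apply/in_centerP => x.
  by rewrite -mulrA hv mulrA hu mulrA.
Qed.

HB.instance Definition _ :=
  GRing.isSubringClosed.Build R (@in_center R) center_subring_closed.

Record center := Center { center_val :> R; _ : center_val \in @in_center R }.

HB.instance Definition _ := [isSub for center_val].
HB.instance Definition _ := [Choice of center by <:].
HB.instance Definition _ := [SubChoice_isSubNzRing of center by <:].

Lemma center_mulC : commutative (@GRing.mul center).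
Proof. by case=> u hu v; apply/val_inj; rewrite /=; move/in_centerP: hu. Qed.

HB.instance Definition _ :=
  GRing.PzRing_hasCommutativeMul.Build center center_mulC.
End Center.

(* R viewed as an algebra over its center *)
Definition over_center (R : nzRingType) : Type := R.

Section OverCenter.
Variable R : nzRingType.
Local Notation K := (center R).

HB.instance Definition _ := GRing.NzRing.on (over_center R).

Definition center_scale (k : K) (x : over_center R) : over_center R :=
  center_val k * (x : R).

Lemma center_scaleA a b v :
  center_scale a (center_scale b v) = center_scale (a * b) v.
Proof. exact: mulrA. Qed.
Lemma center_scale1 : left_id 1 center_scale.
Proof. exact: mul1r. Qed.
Lemma center_scaleDr : right_distributive center_scale +%R.
Proof. by move=> k u v; exact: mulrDr. Qed.
Lemma center_scaleDl v : {morph center_scale^~ v : a b / a + b}.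
Proof. by move=> a b; exact: mulrDl. Qed.

HB.instance Definition _ := GRing.Zmodule_isLmodule.Build K (over_center R)
  center_scaleA center_scale1 center_scaleDr center_scaleDl.

Lemma center_scaleAl (k : K) (x y : over_center R) : k *: (x * y) = k *: x * y.
Proof. exact: mulrA. Qed.

HB.instance Definition _ :=
  GRing.Lmodule_isLalgebra.Build K (over_center R) center_scaleAl.

Lemma center_scaleAr (k : K) (x y : over_center R) : k *: (x * y) = x * (k *: y).
Proof.
by case: k => k hk; move/in_centerP: (hk) => kC;
   rewrite /GRing.scale /= /center_scale /= mulrA kC -mulrA.
Qed.

HB.instance Definition _ :=
  GRing.Lalgebra_isAlgebra.Build K (over_center R) center_scaleAr.
End OverCenter.

Definition algebraic_element (K : comNzRingType) (A : algType K) (a : A) : Prop :=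
  exists2 p : {poly K}, p != 0 & horner_alg a p = 0.

(* [subalgClosed] predicates contain 1, hence are unital subalgebras. *)
Section Subalgebra.
Variables (K : comNzRingType) (A : algType K) (S : subalgClosed A).
Record subalgebra := Subalgebra { subalgebra_val :> A; _ : subalgebra_val \in S }.
HB.instance Definition _ := [isSub for subalgebra_val].
HB.instance Definition _ := [Choice of subalgebra by <:].
HB.instance Definition _ := [SubChoice_isSubAlgebra of subalgebra by <:].
End Subalgebra.

(* The product of the 'M_((n i).+1) has componentwise operations, so an algebra
   morphism into it is a family of algebra morphisms into the factors. *)
Definition matricial_algebra (K : comNzRingType) (A : algType K) : Prop :=
  exists (m : nat) (n : 'I_m.+1 -> nat)
    (f : forall i, {lrmorphism A -> 'M[K]_((n i).+1)}),
    bijective ((fun a i => f i a) : A -> forall i, 'M[K]_((n i).+1)).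

Definition matricial_element (K : comNzRingType) (A : algType K) (a : A) : Prop :=
  exists S : subalgClosed A, a \in S /\ matricial_algebra (subalgebra S).

(* Main.v *)
(** The rank function is used only for two facts: no idempotent is minimal, and,
    since orthogonal idempotents are comparable (a maximal partial isomorphism
    exists because suprema of chains of graphs are graphs), [R] is simple. Hence
    the center of a corner [e R e] is [Z(R) e].

    Let [q] be irreducible over [K = Z(R)] and suppose that [q (a)] kills a nonzero
    ideal. If the right ideals [x R, a x R, ..., a^(r-1) x R] are independent with
    [r] maximal, then [a^r x] is a combination of [x, ..., a^(r-1) x] whose
    coefficients preserve all right ideals of the corner, so they are scalars, and
    [a] satisfies on [x R] an equation of degree [r]; irreducibility forces
    [r = deg q]. This lifts to powers [p = q^j].

    A right ideal [I] maximal among those with [I, a I, ..., a^(n-1) I] independent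
    (where [n = deg p]) exists by Zorn's lemma and meet continuity. The powers of
    [a] together with the dual Horner polynomials of [p] give matrix units with
    which [a] acts as the companion matrix of [p], on an idempotent that commutes
    with [a]; on the complement [q^(j-1) (a)] vanishes by maximality. Induction on
    [j] and the primary decomposition yield a matricial subalgebra containing [a]. *)
Require Import Defs.
From HB Require Import structures.
From mathcomp Require Import all_boot all_order all_algebra.
From mathcomp Require Import all_classical.
From mathcomp Require Import reals.

Set Implicit Arguments.
Unset Strict Implicit.
Unset Printing Implicit Defensive.

Import Order.TTheory GRing.Theory Num.Theory.

Local Open Scope classical_set_scope.
Local Open Scope ring_scope.

(** * Principal right ideals *)

Definition in_ideal (R : nzRingType) (I : right_principal_ideals R) : R -> Prop :=
  ideal_set I.
Coercion in_ideal : right_principal_ideals >-> Funclass.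

Section PrincipalIdeals.
Variable R : nzRingType.
Local Notation L := (right_principal_ideals R).
Implicit Types (I J U : L) (x y z : R).

Lemma right_principalP x : is_right_principal (right_principal x).
Proof. by apply/asboolP; exists x. Qed.

Definition pid x : L := RightPrincipalIdeal (right_principalP x).

Lemma pidP x z : pid x z <-> exists r, z = x * r.
Proof.
split=> [[r _ <-]|[r ->]]; first by exists r.
by exists r.
Qed.

Lemma idealP I : exists x, I = pid x.
Proof.
case: I => A hA; case/asboolP: (hA) => x AE; exists x.
by apply/val_inj.
Qed.

Lemma ideal_leP I J : (I <= J)%O <-> forall z, I z -> J z.
Proof. by rewrite -Order.le_val subsetEset. Qed.

Lemma idealM I z r : I z -> I (z * r).
Proof.
have [x ->] := idealP I => /pidP[s ->]; apply/pidP.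
by exists (s * r); rewrite mulrA.
Qed.

Lemma ideal0 I : I 0.
Proof. by have [x ->] := idealP I; apply/pidP; exists 0; rewrite mulr0. Qed.

Lemma idealD I y z : I y -> I z -> I (y + z).
Proof.
have [x ->] := idealP I => /pidP[r ->] /pidP[s ->]; apply/pidP.
by exists (r + s); rewrite mulrDr.
Qed.

Lemma ideal_sum I (T : Type) (s : seq T) (P : pred T) (F : T -> R) :
  (forall i, P i -> I (F i)) -> I (\sum_(i <- s | P i) F i).
Proof.
move=> h; elim/big_ind: _ => //; [exact: ideal0 | exact: idealD].
Qed.

Lemma pid_gen x : pid x x.
Proof. by apply/pidP; exists 1; rewrite mulr1. Qed.

Lemma pid_leP x I : (pid x <= I)%O <-> I x.
Proof.
split=> [/ideal_leP h|Ix]; first exact/h/pid_gen.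
by apply/ideal_leP => z /pidP[r ->]; exact: idealM.
Qed.

Lemma pid0P z : pid 0 z <-> z = 0.
Proof.
split=> [/pidP[r ->]|->]; first by rewrite mul0r.
exact: pid_gen.
Qed.

Lemma ideal_supremum (A : set L) : continuous_geometry L ->
  exists S, (forall I, A I -> (I <= S)%O) /\
    (forall U, (forall I, A I -> (I <= U)%O) -> (S <= U)%O).
Proof. by move=> cg; have [[S [h1 h2]] _] := cg_complete cg A; exists S. Qed.

(** Meet continuity is applied twice: the meet of the two suprema is a join of meets of some [A t]
    with some [B s], and each of these is zero because [A] and [B] grow together and [s], [t] are
    comparable. Asking [X] and [Y] only to lie below all upper bounds makes the lemma apply to
    images and sums of a supremum. *)
Lemma chain_disjoint (T : Type) (C : set T) (A B : T -> L) (X Y : L) :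
  continuous_geometry L ->
  (forall s t, C s -> C t -> (A s <= A t)%O /\ (B s <= B t)%O \/
                             (A t <= A s)%O /\ (B t <= B s)%O) ->
  (forall t, C t -> forall z, A t z -> B t z -> z = 0) ->
  (forall U, (forall t, C t -> (A t <= U)%O) -> (X <= U)%O) ->
  (forall U, (forall t, C t -> (B t <= U)%O) -> (Y <= U)%O) ->
  forall z, X z -> Y z -> z = 0.
Proof.
move=> cg tot dis leX leY z Xz Yz.
have [[sA sAP] _] := cg_complete cg [set A t | t in C].
have [[sB sBP] _] := cg_complete cg [set B t | t in C].
have XA : (X <= sA)%O by apply: leX => t Ct; apply: sAP.1; exists t.
have YB : (Y <= sB)%O by apply: leY => t Ct; apply: sBP.1; exists t.
have [_ [m mP]] := cg_complete cg [set sB; sA].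
have totA : total_on [set A t | t in C] (fun u v => (u <= v)%O).
  move=> _ _ [s Cs <-] [t Ct <-].
  by have [[? _]|[? _]] := tot _ _ Cs Ct; [left|right].
have totB : total_on [set B t | t in C] (fun u v => (u <= v)%O).
  move=> _ _ [s Cs <-] [t Ct <-].
  by have [[_ ?]|[_ ?]] := tot _ _ Cs Ct; [left|right].
have m0 : (m <= pid 0)%O.
  apply: (cg_meet_continuous cg totA sAP mP).2 => w [_ [t Ct <-] wP].
  rewrite setUC in wP.
  apply: (cg_meet_continuous cg totB sBP wP).2 => w' [_ [s Cs <-] w'P].
  apply/ideal_leP => y w'y; apply/pid0P.
  have At : (w' <= A t)%O by apply: w'P.1; left.
  have Bs : (w' <= B s)%O by apply: w'P.1; right.
  move/ideal_leP: At => /(_ _ w'y) Aty; move/ideal_leP: Bs => /(_ _ w'y) Bsy.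
  have [[/ideal_leP le1 /ideal_leP le2]|[/ideal_leP le1 /ideal_leP le2]] :=
    tot _ _ Cs Ct; first by apply: (dis _ Ct) => //; exact: le2.
  by apply: (dis _ Cs) => //; exact: le1.
apply/pid0P; move/ideal_leP: m0; apply.
apply/pid_leP; apply: mP.2 => _ [->|->]; apply/pid_leP.
  by move/ideal_leP: YB; apply.
by move/ideal_leP: XA; apply.
Qed.

Lemma maximal_ideal_exists (P : L -> Prop) :
  continuous_geometry L -> P (pid 0) ->
  (forall (C : set L) S, (forall I, C I -> P I) ->
     total_on C (fun u v => (u <= v)%O) -> (exists I, C I) ->
     (forall I, C I -> (I <= S)%O) ->
     (forall U, (forall I, C I -> (I <= U)%O) -> (S <= U)%O) -> P S) ->
  exists I, P I /\ forall J, P J -> (I <= J)%O -> J = I.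
Proof.
move=> cg P0 Psup.
pose T := {I : L | P I}.
pose le (s t : T) : bool := (sval s <= sval t)%O.
have [| | | |[I PI] Imax] := @Zorn T le.
- by move=> t; exact: lexx.
- by move=> r s t; exact: le_trans.
- move=> [s Ps] [t Pt] st ts; apply: eq_exist => /=.
  by apply/eqP; rewrite eq_le; apply/andP.
(* [Psup] speaks of nonempty chains only; the empty chain is bounded by the zero ideal. *)
- move=> A totA; have [[t0 At0]|noA] := pselect (exists t, A t); last first.
    by exists (exist _ _ P0) => s As; case: noA; exists s.
  have [S [ubS lubS]] := ideal_supremum [set sval t | t in A] cg.
  suff PS : P S by exists (exist _ _ PS) => s As; apply: ubS; exists s.
  apply: (Psup [set sval t | t in A]) => //.
  - by move=> _ [t _ <-]; exact: svalP.
  - by move=> _ _ [s As <-] [t At <-]; exact: totA.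
  - by exists (sval t0); exists t0.
exists I; split=> // J PJ IJ.
by have := Imax (exist _ _ PJ) IJ; case.
Qed.

(** * Principal right ideals of a regular ring *)

Section Regular.
Hypothesis reg : regular_ring R.

Lemma ideal_idem I : exists e, e * e = e /\ forall z, I z <-> e * z = z.
Proof.
have [x ->] := idealP I; have [b xbx] := reg x.
exists (x * b); split=> [|z]; first by rewrite mulrA xbx.
split=> [/pidP[r ->]|<-]; first by rewrite mulrA xbx.
by apply/pidP; exists (b * z); rewrite mulrA.
Qed.

Lemma idem_ideal e : e * e = e -> forall z, pid e z <-> e * z = z.
Proof.
move=> ee z; split=> [/pidP[r ->]|<-]; first by rewrite mulrA ee.
by apply/pidP; exists z.
Qed.

(** If [y * b * y = y], the annihilator is generated by the idempotent [1 - b * y]. *)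
Lemma rann_ideal y : exists I, forall z, I z <-> y * z = 0.
Proof.
have [b yby] := reg y; exists (pid (1 - b * y)) => z; split.
  by case/pidP=> r ->; rewrite mulrA mulrBr mulr1 mulrA yby subrr mul0r.
move=> yz; apply/pidP; exists z.
by rewrite mulrBl mul1r -mulrA yz mulr0 subr0.
Qed.

(** For [I = e R], the element [a * z] lies in [I] exactly when [(1 - e) * a] annihilates [z]. *)
Lemma preimage_ideal a I : exists J, forall z, J z <-> I (a * z).
Proof.
have [e [ee Ie]] := ideal_idem I; have [J JP] := rann_ideal ((1 - e) * a).
exists J => z; rewrite JP Ie -mulrA mulrBl mul1r; split=> [/eqP|->].
  by rewrite subr_eq0 => /eqP.
by rewrite subrr.
Qed.

Lemma image_ideal a I : exists J, forall z, J z <-> exists2 y, I y & z = a * y.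
Proof.
have [x ->] := idealP I; exists (pid (a * x)) => z; split.
  case/pidP=> r ->; exists (x * r); last by rewrite mulrA.
  by apply/pidP; exists r.
by case=> y /pidP[r ->] ->; apply/pidP; exists r; rewrite mulrA.
Qed.

(** For [I = e R] and [J = y R] the sum is [e R + (1 - e) y R]. Its second summand is generated by
    an idempotent [h] orthogonal to [e], so [e + h] generates the whole. *)
Lemma join_ideal I J :
  exists M : L, forall z, M z <-> exists u v, [/\ I u, J v & z = u + v].
Proof.
have [e [ee Ie]] := ideal_idem I; have [y JE] := idealP J.
have [b ybyE] := reg ((1 - e) * y).
(* The final factor [1 - e] is what gives [h * e = 0]. *)
pose h := (1 - e) * y * b * (1 - e).
have eC : e * (1 - e) = 0 by rewrite mulrBr mulr1 ee subrr.
have Ce : (1 - e) * e = 0 by rewrite mulrBl mul1r ee subrr.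
have eh : e * h = 0 by rewrite /h !mulrA eC !mul0r.
have he : h * e = 0 by rewrite /h -mulrA Ce mulr0.
have hy : h * y = (1 - e) * y by rewrite -[RHS]ybyE /h !mulrA.
have hC : h * (1 - e) = h by rewrite mulrBr mulr1 he subr0.
have hh : h * h = h by rewrite {2}/h !mulrA hC hy.
exists (pid (e + h)) => z; split=> [/pidP[r ->]|[u [v [Iu Jv ->]]]].
  pose s := b * (1 - e) * r.
  exists (e * (r - y * s)), (y * s); split.
  - by apply/Ie; rewrite mulrA ee.
  - by rewrite JE; apply/pidP; exists s.
  have -> : (e + h) * r = e * r + (1 - e) * (y * s).
    by rewrite mulrDl /h /s !mulrA.
  by rewrite mulrBr mulrBl mul1r addrCA addrC.
apply: idealD.
  have eu := (Ie u).1 Iu.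
  by apply/pidP; exists u; rewrite mulrDl -[in h * u]eu mulrA he mul0r addr0.
move: Jv; rewrite JE => /pidP[r ->]; apply: idealM; apply/pidP.
exists (e * y + h * y).
clearbody h; rewrite mulrDl !mulrDr !mulrA ee eh he hh !mul0r addr0 add0r hy.
by rewrite mulrBl mul1r addrC subrK.
Qed.

End Regular.
End PrincipalIdeals.

(** * Primeness *)

Record central_idempotent (R : nzRingType) := CentralIdempotent {
  central_idem :> R;
  central_idemK : central_idem * central_idem = central_idem;
  central_idemC : forall x, central_idem * x = x * central_idem;
  central_idem_neq0 : central_idem != 0
}.

(** * Corner rings of central idempotents *)

Section CornerRing.
Variables (R : nzRingType) (e : central_idempotent R).

Definition in_corner : {pred R} := fun x => (e : R) * x == x.

Lemma in_cornerP x : reflect ((e : R) * x = x) (x \in in_corner).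
Proof. exact: eqP. Qed.

Lemma corner_zmod_closed : zmod_closed in_corner.
Proof.
split; first by apply/in_cornerP; rewrite mulr0.
by move=> x y /in_cornerP ex /in_cornerP ey; apply/in_cornerP; rewrite mulrBr ex ey.
Qed.

HB.instance Definition _ :=
  GRing.isZmodClosed.Build R in_corner corner_zmod_closed.

Record corner := Corner { corner_val : R; _ : corner_val \in in_corner }.
HB.instance Definition _ := [isSub for corner_val].
HB.instance Definition _ := [Choice of corner by <:].
HB.instance Definition _ := [SubChoice_isSubZmodule of corner by <:].

Lemma corner_proj_subproof x : (e : R) * x \in in_corner.
Proof. by apply/in_cornerP; rewrite mulrA central_idemK. Qed.

Definition corner_proj x : corner := Corner (corner_proj_subproof x).

Definition corner_one : corner := corner_proj 1.
(** The projection leaves such a product unchanged and supplies its membership in the corner. *)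
Definition corner_mul (x y : corner) : corner :=
  corner_proj (corner_val x * corner_val y).

Lemma corner_valK (x : corner) : (e : R) * corner_val x = corner_val x.
Proof. by case: x => x hx; exact/in_cornerP. Qed.

Lemma corner_mulA : associative corner_mul.
Proof.
move=> x y z; apply: val_inj; rewrite /= !mulrA central_idemK corner_valK.
by rewrite -(central_idemC e) corner_valK.
Qed.
Lemma corner_mul1 : left_id corner_one corner_mul.
Proof. by move=> x; apply: val_inj; rewrite /= mulr1 !corner_valK. Qed.
Lemma corner_mulr1 : right_id corner_one corner_mul.
Proof.
move=> x; apply: val_inj; rewrite /= mulr1 -(central_idemC e) !corner_valK //.
Qed.
Lemma corner_mulDl : left_distributive corner_mul +%R.
Proof. by move=> x y z; apply: val_inj; rewrite /= mulrDl mulrDr. Qed.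
Lemma corner_mulDr : right_distributive corner_mul +%R.
Proof. by move=> x y z; apply: val_inj; rewrite /= mulrDr mulrDr. Qed.
Lemma corner_one_neq0 : corner_one != 0.
Proof. by rewrite -(inj_eq val_inj) /= mulr1 central_idem_neq0. Qed.

HB.instance Definition _ := GRing.Zmodule_isNzRing.Build corner
  corner_mulA corner_mul1 corner_mulr1 corner_mulDl corner_mulDr corner_one_neq0.

Lemma corner_projB : {morph corner_proj : x y / x - y}.
Proof. by move=> x y; apply: val_inj; rewrite /= mulrBr. Qed.

Lemma corner_projM : {morph corner_proj : x y / x * y}.
Proof.
move=> x y; apply: val_inj; rewrite /= !mulrA !central_idemK.
by rewrite -(mulrA (e : R) x (e : R)) -(central_idemC e x) mulrA central_idemK.
Qed.
End CornerRing.

Section CentralSplit.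
Variables (R : nzRingType) (e f : central_idempotent R).

Definition corner_split (x : R) : corner e * corner f :=
  (corner_proj e x, corner_proj f x).

Lemma corner_split_is_additive : {morph corner_split : x y / x - y}.
Proof. by move=> x y; rewrite /corner_split !corner_projB. Qed.

Lemma corner_split_is_multiplicative : monoid_morphism corner_split.
Proof. by split=> // x y; rewrite /corner_split !corner_projM. Qed.

HB.instance Definition _ := GRing.isZmodMorphism.Build R _ corner_split
  corner_split_is_additive.
HB.instance Definition _ := GRing.isMonoidMorphism.Build R _ corner_split
  corner_split_is_multiplicative.
End CentralSplit.

(** Otherwise [R] would be the product of the nonzero corners of [e] and [1 - e]. *)
Lemma irreducible_central_idem (R : nzRingType) (e : R) : irreducible_ring R ->
  e * e = e -> (forall x, e * x = x * e) -> e != 0 -> e = 1.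
Proof.
move=> irr ee eC e0; apply/eqP; apply: contra_notT irr => e1.
have ff : (1 - e) * (1 - e) = 1 - e.
  by rewrite mulrBr mulr1 mulrBl mul1r ee subrr subr0.
have fC x : (1 - e) * x = x * (1 - e) by rewrite mulrBl mulrBr mul1r mulr1 eC.
have f0 : 1 - e != 0 by rewrite subr_eq0 eq_sym.
pose E := CentralIdempotent ee eC e0; pose F := CentralIdempotent ff fC f0.
exists (corner E : nzRingType), (corner F : nzRingType), (@corner_split R E F).
exists (fun u => corner_val u.1 + corner_val u.2) => [x|[u v]].
  by rewrite /= mulrBl mul1r addrC subrK.
have eu := corner_valK u; have fv := corner_valK v.
rewrite /= in eu fv.
congr (_, _); apply: val_inj; rewrite /= mulrDr.
  by rewrite eu -fv mulrA mulrBr mulr1 ee subrr mul0r addr0.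
by rewrite fv -eu mulrA mulrBl mul1r ee subrr mul0r add0r.
Qed.

Definition prime_ring (R : nzRingType) :=
  forall x y : R, x != 0 -> y != 0 -> exists r, x * r * y != 0.

Section Prime.
Variable R : nzRingType.
Hypotheses (reg : regular_ring R).
Local Notation L := (right_principal_ideals R).

Lemma regular_semiprime (x : R) : (forall s, x * s * x = 0) -> x = 0.
Proof. by move=> h; have [b <-] := reg x. Qed.

(* The supremum of the ideals [r x R] is a two-sided ideal [e R], and in a
   semiprime ring this forces [e] to be central. *)
Lemma continuous_prime : irreducible_ring R -> continuous_geometry L ->
  prime_ring R.
Proof.
move=> irr cg x y x0; apply: contraPP => /forallNP xy.
have {}xy r : x * r * y = 0 by apply: contra_notP (xy r) => /eqP.
(* Each [(y r x) s (y r x)] contains a factor [x (s y r) x] preceded by [y r], and also the block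
   [x s y], which vanishes. *)
have yx r : y * r * x = 0.
  apply: regular_semiprime => s.
  by rewrite -!mulrA (mulrA x) (mulrA (x * s)) xy mul0r !mulr0.
have [S [ubS lubS]] := ideal_supremum [set pid (r * x) | r in [set: R]] cg.
have [e [ee Se]] := ideal_idem reg S.
have Srx r : S (r * x) by apply/pid_leP; apply: ubS; exists r.
have Sl r z : S z -> S (r * z).
  have [J JP] := preimage_ideal reg r S.
  have SJ : (S <= J)%O.
    apply: lubS => _ [s _ <-]; apply/pid_leP/JP.
    by rewrite mulrA.
  by move/ideal_leP: SJ => SJ /SJ/JP.
have Cre r : (1 - e) * r * e = 0.
  have : S (r * e) by apply: Sl; apply/Se.
  by move/Se => h; rewrite mulrBl mul1r mulrBl -mulrA h subrr.
have erC r : e * r * (1 - e) = 0.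
  apply: regular_semiprime => s.
  rewrite -!mulrA (mulrA (1 - e)) (mulrA ((1 - e) * s)) Cre mul0r !mulr0 //.
have eC r : e * r = r * e.
  transitivity (e * r * e); apply/eqP; rewrite -subr_eq0.
    by rewrite -{1}[e * r]mulr1 -mulrBr erC.
  by rewrite -opprB oppr_eq0 -mulrBl -{1}[r]mul1r -mulrBl Cre.
have ex : e * x = x by apply/Se; rewrite -[x]mul1r.
have e0 : e != 0 by apply: contra_neq x0 => e0; rewrite -ex e0 mul0r.
have e1 := irreducible_central_idem irr ee eC e0.
(* Now [S] is all of [R], while every [r * x] lies in the right annihilator [N] of [y]; hence [1] is
   in [N]. *)
have [N NP] := rann_ideal reg y.
have SN : (S <= N)%O.
  by apply: lubS => _ [r _ <-]; apply/pid_leP/NP; rewrite mulrA.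
move/ideal_leP: SN => /(_ 1) SN.
apply/negP; rewrite negbK; apply/eqP.
have /NP : N 1 by apply: SN; apply/Se; rewrite mulr1.
by rewrite mulr1.
Qed.

Hypothesis prm : prime_ring R.

(** In a prime ring a nonzero central element is not a zero divisor, so it can be cancelled from
    [z * b * z = z]. *)
Lemma prime_center_inv (z : R) : (forall x, z * x = x * z) -> z != 0 ->
  exists2 w, (forall x, w * x = x * w) & w * z = 1.
Proof.
move=> zC z0; have [b zbz] := reg z.
have zI t : z * t = 0 -> t = 0.
  move=> zt; apply/eqP; apply: contraT => t0.
  by have [r] := prm z0 t0; rewrite zC -mulrA zt mulr0 eqxx.
have bz : b * z = 1.
  by apply/eqP; rewrite -subr_eq0; apply/eqP/zI; rewrite mulrBr mulr1 mulrA zbz subrr.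
exists b => // x; apply/eqP; rewrite -subr_eq0; apply/eqP/zI.
by rewrite mulrBr !mulrA zC bz mul1r zC -mulrA zC bz mulr1 subrr.
Qed.
End Prime.

(** * Comparability and simplicity *)

Definition subidem (R : nzRingType) (e f : R) : Prop :=
  [/\ f * f = f, e * f = f & f * e = f].

Definition atomless_ring (R : nzRingType) : Prop :=
  forall e : R, e * e = e -> e != 0 -> exists f, [/\ subidem e f, f != 0 & f != e].

Lemma subidemB (R : nzRingType) (e f : R) :
  e * e = e -> subidem e f -> subidem e (e - f).
Proof.
move=> ee [ff ef fe]; split; last 2 first.
- by rewrite mulrBr ee ef.
- by rewrite mulrBl ee fe.
by rewrite mulrBr !mulrBl ee ef fe ff subrr subr0.
Qed.

(** Let [e] be a minimal idempotent. For [y != 0] primeness gives a nonzero [e r y], which yields a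
    nonzero idempotent below [e], hence [e] itself; so [rk e <= rk y]. Balls of radius [rk e] are
    then singletons and the topology is discrete. *)
Lemma nondiscrete_atomless (F : realType) (R : nzRingType) :
  regular_ring R -> prime_ring R -> nondiscrete_ring F R -> atomless_ring R.
Proof.
move=> reg prm [rk rkP ndis] e ee e0; apply: contra_notP ndis => noatom.
have rk_le y : y != 0 -> rk e <= rk y.
  move=> y0; have [r ery0] := prm _ _ e0 y0; move zE: (e * r * y) ery0 => z ery0.
  have [w zwz] := reg z; have ez : e * z = z by rewrite -zE !mulrA ee.
  have sub : subidem e (z * w * e).
    split; last 2 first.
    - by rewrite !mulrA ez.
    - by rewrite -!mulrA ee.
    by rewrite -[_ * _ * (_ * _ * e)]mulrA !(mulrA e) ez !mulrA zwz.
  have f0 : z * w * e != 0.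
    by apply: contra_neq ery0 => h; rewrite -zwz -{2}ez !mulrA h mul0r.
  have fe : z * w * e = e.
    by apply/eqP; apply: contra_notT noatom => fe; exists (z * w * e).
  rewrite -{1}fe -mulrA.
  have := rankM rkP z (w * e); rewrite le_min => /andP[le1 _].
  apply: (le_trans le1).
  by have := rankM rkP (e * r) y; rewrite zE le_min => /andP[].
move=> U x Ux; exists (rk e); first exact: (rank_gt0 rkP).
move=> y /= lt_xy; suff -> : y = x by [].
apply/eqP; rewrite eq_sym -subr_eq0; apply: contraLR lt_xy.
by move=> /rk_le; rewrite -leNgt.
Qed.

Section Comparability.
Variable R : nzRingType.
Hypotheses (reg : regular_ring R) (prm : prime_ring R).
Local Notation L := (right_principal_ideals R).
Implicit Types (e f : R) (G : L).

(* [G] is the graph of an isomorphism between a part of [e R] and a part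
   of [f R]. *)
Definition is_graph e f G : Prop :=
  forall z, G z -> [/\ (e + f) * z = z, e * z = 0 -> z = 0 & f * z = 0 -> z = 0].

(** The condition [e * t = e] says that the graph projects onto [e R]. Then [v = f t e] is the map
    it describes; the graph condition makes [v] injective on [e R], and regularity turns this into a
    left inverse [u]. *)
Lemma graph_subequiv e f G t : e * e = e -> f * f = f ->
  is_graph e f G -> G t -> e * t = e ->
  exists u v, [/\ u * v = e, e * u = u, u * f = u, f * v = v & v * e = v].
Proof.
move=> ee ff gr Gt et; pose v := f * t * e.
have [w vwv] := reg v.
have ve : v * e = v by rewrite /v -mulrA ee.
have fv : f * v = v by rewrite /v !mulrA ff.
have vI r : v * r = 0 -> e * r = 0.
  move=> vr; have Gtr : G (t * (e * r)) by exact: idealM.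
  have [_ _ /(_ _) h] := gr _ Gtr.
  have : t * (e * r) = 0 by apply: h; rewrite !mulrA.
  by move/(congr1 ( *%R e)); rewrite mulr0 !mulrA et ee.
have ewv : e * w * v = e.
  have : e * (w * v - e) = 0 by apply: vI; rewrite mulrBr mulrA vwv ve subrr.
  by rewrite mulrBr ee mulrA => /eqP; rewrite subr_eq0 => /eqP.
exists (e * w * f), v; split=> //.
- by rewrite -[_ * f * v]mulrA fv.
- by rewrite !mulrA ee.
- by rewrite -!mulrA ff.
Qed.

(** Here [e2] generates a complement of the proper subideal [e t R] inside [e R]. *)
Lemma compl_generator e t : e * e = e -> ~ (exists s, e = e * t * s) ->
  exists e2, [/\ e2 != 0, e2 * e2 = e2, e * e2 = e2, e2 * e = e2 & e2 * t = 0].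
Proof.
move=> ee nt; have [w] := reg (e * t); rewrite !mulrA => etw.
exists (e - e * t * w * e).
have h : e * (e * t * w * e) = e * t * w * e by rewrite !mulrA ee.
have h' : e * t * w * e * e = e * t * w * e by rewrite -mulrA ee.
have h2 : e * t * w * e * (e * t * w * e) = e * t * w * e.
  by rewrite !mulrA h' etw.
split.
- rewrite subr_eq0; apply: contra_notN nt => /eqP eE.
  by exists (w * e); rewrite mulrA.
- by rewrite mulrBr !mulrBl ee h h' h2 subrr subr0.
- by rewrite mulrBr ee h.
- by rewrite mulrBl ee h'.
- by rewrite mulrBl etw subrr.
Qed.

Hypothesis cg : continuous_geometry L.

(** The condition [(e + f) * z = z] is an annihilator condition and so passes to suprema. The two
    injectivity conditions pass by [chain_disjoint], with the annihilator of [e] or [f] as a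
    constant second family. *)
Lemma maximal_graph e f : exists G, is_graph e f G /\
  forall G', is_graph e f G' -> (G <= G')%O -> G' = G.
Proof.
apply: maximal_ideal_exists => //.
  by move=> z /pid0P ->; split; rewrite ?mulr0.
move=> C S gr tot [I0 CI0] ubS lubS z Sz.
have [U UP] := rann_ideal reg (1 - (e + f)).
have SU : (S <= U)%O.
  apply: lubS => I CI; apply/ideal_leP => y Iy; apply/UP.
  by have [h _ _] := gr _ CI _ Iy; rewrite mulrBl mul1r h subrr.
move/ideal_leP: SU => /(_ _ Sz)/UP.
rewrite mulrBl mul1r => /eqP; rewrite subr_eq0 => /eqP zE.
have disj g : (forall I, C I -> forall y, I y -> g * y = 0 -> y = 0) ->
    g * z = 0 -> z = 0.
  move=> h gz; have [N NP] := rann_ideal reg g.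
  apply: (@chain_disjoint _ _ C id (fun=> N) S N cg) => //.
  - by move=> s t Cs Ct; case: (tot _ _ Cs Ct); [left|right].
  - by move=> I CI y Iy Ny; apply: (h I CI y Iy); exact/NP.
  - by move=> U' h'; exact: h' CI0.
  - exact/NP.
split=> //; apply: disj => I CI y Iy; by have [_ ? ?] := gr _ CI _ Iy.
Qed.

(** If a maximal graph covers neither [e R] nor [f R], nonzero idempotents [e2] and [f2] are left
    over on the two sides. Primeness links them by some [z] in [e2 R f2], and this allows the graph
    to be enlarged. *)
Lemma comparability e f : e * e = e -> f * f = f -> e * f = 0 -> f * e = 0 ->
  (exists u v, [/\ u * v = e, e * u = u, u * f = u, f * v = v & v * e = v]) \/
  (exists u v, [/\ u * v = f, f * u = u, u * e = u, e * v = v & v * f = v]).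
Proof.
move=> ee ff ef fe; have [G [gr Gmax]] := maximal_graph e f.
have gr' : is_graph f e G by move=> z /gr[h1 h2 h3]; split; rewrite // addrC.
have [t GE] := idealP G.
have Gts s : G (t * s) by rewrite GE; apply/pidP; exists s.
have [[s es]|not_e] := pselect (exists s, e = e * t * s).
  by left; apply: (graph_subequiv ee ff gr (Gts s)); rewrite mulrA -es.
have [[s fs]|not_f] := pselect (exists s, f = f * t * s).
  by right; apply: (graph_subequiv ff ee gr' (Gts s)); rewrite mulrA -fs.
exfalso.
have [e2 [e20 e2e2 ee2 e2e e2t]] := compl_generator ee not_e.
have [f2 [f20 f2f2 ff2 f2f f2t]] := compl_generator ff not_f.
have [r] := prm e20 f20; move zE: (e2 * r * f2) => z z0.
have [w zwz] := reg z.
have e2z : e2 * z = z by rewrite -zE !mulrA e2e2.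
have zf2 : z * f2 = z by rewrite -zE -mulrA f2f2.
have ez : e * z = z by rewrite -e2z mulrA ee2.
have ef2 : e * f2 = 0 by rewrite -ff2 mulrA ef mul0r.
have fz : f * z = 0 by rewrite -ez mulrA fe mul0r.
have f2z : f2 * z = 0 by rewrite -f2f -mulrA fz mulr0.
(* [y R] is the graph of the map [z r -> f2 w z r], which is injective because
   [z * f2 * w * z = z]. *)
pose y := z + f2 * w * z.
have ey : e * y = z by rewrite /y mulrDr ez !mulrA ef2 !mul0r addr0.
have fy : f * y = f2 * w * z by rewrite /y mulrDr fz !mulrA ff2 add0r.
have efy : (e + f) * y = y by rewrite mulrDl ey fy.
have yr s : z * s = 0 -> y * s = 0.
  by move=> zs; rewrite /y mulrDl zs -mulrA zs mulr0 addr0.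
have [G' G'P] := join_ideal reg G (pid y).
have GG' : (G <= G')%O.
  apply/ideal_leP => x Gx; apply/G'P; exists x, 0; rewrite addr0.
  by split=> //; exact: ideal0.
have G'y : G' y.
  by apply/G'P; exists 0, y; rewrite add0r; split=> //; [exact: ideal0|exact: pid_gen].
have gr2 : is_graph e f G'.
  move=> _ /G'P[u [_ [Gu /pidP[s ->] ->]]]; have [h1 h2 h3] := gr _ Gu.
  move: (Gu); rewrite {1}GE => /pidP[k uE].
  clearbody y; split.
  - by rewrite mulrDr h1 mulrA efy.
  - rewrite mulrDr mulrA ey => h.
    have zs : z * s = 0.
      move/(congr1 ( *%R e2)): h; rewrite mulr0 mulrDr !mulrA e2e e2z.
      by rewrite uE mulrA e2t mul0r add0r.
    by move: h; rewrite zs yr // !addr0.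
  - rewrite mulrDr mulrA fy => h.
    have zs : z * s = 0.
      move/(congr1 ( *%R (z * f2))): h; rewrite mulr0 mulrDr !mulrA.
      rewrite -(mulrA z f2 f) f2f -(mulrA z f2 f2) f2f2 uE !mulrA -(mulrA z f2 t) f2t.
      by rewrite mulr0 !mul0r add0r zf2 zwz.
    by move: h; rewrite -mulrA zs mulr0 yr // !addr0.
have := Gmax _ gr2 GG' => G'G.
move: G'y; rewrite G'G GE => /pidP[s ys].
by move: z0; rewrite -e2z -ey ys mulrA e2e mulrA e2t mul0r eqxx.
Qed.

Definition in_two_sided e z : Prop :=
  exists s : seq (R * R), z = \sum_(p <- s) p.1 * e * p.2.

Lemma in_two_sidedD e y z :
  in_two_sided e y -> in_two_sided e z -> in_two_sided e (y + z).
Proof. by move=> [s ->] [t ->]; exists (s ++ t); rewrite big_cat. Qed.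

Lemma in_two_sided_gen e u v : in_two_sided e (u * e * v).
Proof. by exists [:: (u, v)]; rewrite big_seq1. Qed.

(** Let [h] be an idempotent of [R e R] above [e]. By comparability either [1 - h] embeds into [e],
    which puts [1] into [R e R], or [1 - h] contains a copy of [e], which enlarges [h] and raises
    its rank by at least [rk e]. Ranks are at most 1, so the second case cannot recur forever. *)
Lemma rank_simple (F : realType) (rk : R -> F) e : rank_function rk ->
  e * e = e -> e != 0 -> in_two_sided e 1.
Proof.
move=> rkP ee e0; apply: contrapT => not1.
have step N : exists h, [/\ subidem h e, h * h = h, in_two_sided e h &
    N%:R * rk e <= rk h].
  elim: N => [|N [h [[_ he eh] hh Th Nh]]].
    exists e; split=> //; first by have := in_two_sided_gen e 1 1; rewrite mul1r mulr1.
    by rewrite mul0r; case/andP: (rank_itv rkP e).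
  have ff : (1 - h) * (1 - h) = 1 - h.
    by rewrite mulrBr mulr1 mulrBl mul1r hh subrr subr0.
  have hf : h * (1 - h) = 0 by rewrite mulrBr mulr1 hh subrr.
  have fh : (1 - h) * h = 0 by rewrite mulrBl mul1r hh subrr.
  have ef : e * (1 - h) = 0 by rewrite mulrBr mulr1 eh subrr.
  have fe : (1 - h) * e = 0 by rewrite mulrBl mul1r he subrr.
  have [[u [v [uv eu uf fv ve]]]|[u [v [uv fu ue ev vf]]]] :=
    comparability ee ff ef fe; last first.
    case: not1; rewrite -[1](subrK h) addrC; apply: in_two_sidedD => //.
    by rewrite -uv -ue; exact: in_two_sided_gen.
  have idem : v * u * (v * u) = v * u by rewrite mulrA -(mulrA v) uv ve.
  have hvu : h * (v * u) = 0 by rewrite -fv !mulrA hf !mul0r.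
  have vuh : v * u * h = 0 by rewrite -uf -!mulrA fh !mulr0.
  exists (h + v * u); split.
  - split=> //; first by rewrite mulrDl he -mulrA -uf -mulrA fe !mulr0 addr0.
    by rewrite mulrDr eh -fv !mulrA ef !mul0r addr0.
  - by rewrite mulrDr !mulrDl hh hvu vuh idem addr0 add0r.
  - by apply: in_two_sidedD => //; rewrite -ve; exact: in_two_sided_gen.
  (* The added piece has rank at least [rk e], since [e = u (v u) v]. *)
  rewrite (rankD rkP hh idem hvu vuh) -addn1 natrD mulrDl mul1r lerD //.
  have -> : e = u * (v * u) * v by rewrite -!mulrA uv ve uv.
  have := rankM rkP (u * (v * u)) v; rewrite le_min => /andP[le1 _].
  apply: (le_trans le1).
  by have := rankM rkP u (v * u); rewrite le_min => /andP[].
have rke : 0 < rk e by exact: (rank_gt0 rkP).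
have [h [_ _ _]] := step (Num.Def.archi_bound ((rk e)^-1)).
have /andP[_ rkh] := rank_itv rkP h.
move=> /le_trans/(_ rkh); rewrite leNgt -ltr_pdivrMr // mul1r.
by rewrite archi_boundP // invr_ge0 ltW.
Qed.

End Comparability.

(** * Scalars in the corners [e R e] *)

Section CornerCenter.
Variable R : nzRingType.
Hypotheses (prm : prime_ring R) (atl : atomless_ring R).
Hypothesis simple : forall e : R, e * e = e -> e != 0 -> in_two_sided e 1.

(** Preserving [f R] and [(e - f) R] makes [c] commute with every idempotent [f] below [e]. As
    [f + f r (e - f)] is again such an idempotent, [c] commutes with off-diagonal elements, and
    primeness carries this over to the diagonal ones. *)
Lemma corner_commute (e c : R) : e * e = e -> e * c = c -> c * e = c ->
  (forall f, subidem e f -> c * f = f * c * f) ->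
  forall r, c * (e * r * e) = e * r * e * c.
Proof.
move=> ee ec ce cf.
have [->|e0] := eqVneq e 0; first by move=> r; rewrite !mul0r mulr0.
have cC f : subidem e f -> c * f = f * c.
  move=> sf; have [ff ef fe] := sf.
  have fg : f * (e - f) = 0 by rewrite mulrBr fe ff subrr.
  have : f * (c * (e - f)) = 0 by rewrite (cf _ (subidemB ee sf)) !mulrA fg !mul0r.
  rewrite mulrA mulrBr -(mulrA f c e) ce -(cf _ sf) => /eqP.
  by rewrite subr_eq0 => /eqP.
have off f r : subidem e f -> c * (f * r * (e - f)) = f * r * (e - f) * c.
  move=> sf; have [ff ef fe] := sf.
  have gf : (e - f) * f = 0 by rewrite mulrBl ef ff subrr.
  have ge : (e - f) * e = e - f by rewrite mulrBl ee fe.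
  have sk : subidem e (f + f * r * (e - f)).
    have mf : f * r * (e - f) * f = 0 by rewrite -mulrA gf mulr0.
    have fm : f * (f * r * (e - f)) = f * r * (e - f) by rewrite !mulrA ff.
    have em : e * (f * r * (e - f)) = f * r * (e - f) by rewrite !mulrA ef.
    have me : f * r * (e - f) * e = f * r * (e - f) by rewrite -mulrA ge.
    move: (f * r * (e - f)) mf fm em me => m mf fm em me.
    split; last 2 first.
    - by rewrite mulrDr ef em.
    - by rewrite mulrDl fe me.
    have mm : m * m = 0 by rewrite -{2}fm mulrA mf mul0r.
    by rewrite mulrDl !mulrDr ff fm mf mm add0r addr0.
  by have := cC _ sk; rewrite mulrDr mulrDl (cC _ sf) => /addrI.
(* The diagonal argument for one of [f], [e - f] needs the other one to be nonzero. *)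
have [f [sf f0 fe0]] := atl ee e0.
have diag g : subidem e g -> e - g != 0 -> forall r, c * (g * r * g) = g * r * g * c.
  move=> sg g'0 r; have [gg eg ge] := sg.
  apply/eqP; rewrite -subr_eq0; apply: contraT => nz.
  (* It suffices that the commutator annihilates every [s * (e - g)]; both [g r g s (e - g)] and
     [g s (e - g)] are off-diagonal. *)
  have [s] := prm nz g'0; apply: contraNT => _; apply/eqP.
  rewrite !mulrBl; apply/eqP; rewrite subr_eq0; apply/eqP.
  have := off g (r * g * s) sg; rewrite !mulrA => ->.
  rewrite -!mulrA; congr (g * (r * _)); rewrite !mulrA.
  by have := off g s sg; rewrite !mulrA -(cC _ sg) => ->.
have sg := subidemB ee sf.
have g0 : e - f != 0 by rewrite subr_eq0 eq_sym.
have diag_f := diag f sf g0; have off_f := off f ^~ sf.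
have diag_g := diag (e - f) sg; have off_g := off (e - f) ^~ sg.
have eE : e = f + (e - f) by rewrite addrC subrK.
rewrite subKr in diag_g; rewrite subKr in off_g.
move: (e - f) eE {sg g0 diag} diag_f diag_g off_f off_g => g eE.
move=> diag_f diag_g off_f off_g r.
have -> : e * r * e = (f * r * f + f * r * g) + (g * r * f + g * r * g).
  by rewrite -!mulrDr -eE -!mulrDl -eE.
by rewrite 3!mulrDr 3!mulrDl diag_f diag_g // off_f off_g.
Qed.

(** Simplicity writes [1] as a sum of terms [p.1 * e * p.2]; replacing [e] by [c] in it defines [k].
    Since [c] commutes with the corner, multiplying [x * e * y] by [k] on either side gives
    [x * c * y], so [k] is central and [k * e = c]. *)
Lemma corner_center (e c : R) : e * e = e -> e * c = c -> c * e = c ->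
  (forall f, subidem e f -> c * f = f * c * f) ->
  exists2 k, (forall x, k * x = x * k) & c = k * e.
Proof.
move=> ee ec ce cf; have cC := corner_commute ee ec ce cf.
have [e0|e0] := eqVneq e 0.
  by exists 0; [move=> x; rewrite mulr0 mul0r|rewrite -ce e0 !mulr0].
have [s s1] := simple ee e0.
have {}cC r : c * r * e = e * r * c.
  by have := cC r; rewrite -(mulrA (e * r)) ec !mulrA ce.
pose k := \sum_(p <- s) p.1 * c * p.2.
have kl x y : k * (x * e * y) = x * c * y.
  rewrite -[RHS]mul1r s1 !mulr_suml; apply: eq_bigr => p _.
  transitivity (p.1 * (c * (p.2 * x) * e) * y); first by rewrite !mulrA.
  by rewrite cC !mulrA.
have kr x y : x * e * y * k = x * c * y.
  rewrite -[RHS]mulr1 s1 !mulr_sumr; apply: eq_bigr => p _.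
  transitivity (x * (e * (y * p.1) * c) * p.2); first by rewrite !mulrA.
  by rewrite -cC !mulrA.
clearbody k; exists k; last by have := kl 1 1; rewrite !mulr1 !mul1r.
move=> x; rewrite -[x]mulr1 s1 !mulr_sumr mulr_suml; apply: eq_bigr => p _.
by rewrite !(mulrA x) kl kr.
Qed.

End CornerCenter.

(** * Independence of powers *)

Section RightIndependence.
Variable R : nzRingType.
Implicit Types (x y : nat -> R) (e : R).

(** This is injectivity of the map from [(e R)^n] to [R] that sends [r] to the sum of the
    [y k * r k]. *)
Definition right_indep n y e : Prop :=
  [/\ e * e = e, forall k, (k < n)%N -> y k * e = y k &
   forall r : nat -> R, \sum_(k < n) y k * r k = 0 ->
     forall k, (k < n)%N -> e * r k = 0].

Lemma right_indep_widen m n y e :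
  (m <= n)%N -> right_indep n y e -> right_indep m y e.
Proof.
move=> mn [ee ye ind]; split=> // [k km|r h k km].
  by apply: ye; exact: leq_trans mn.
have := ind (fun i => if (i < m)%N then r i else 0).
rewrite (big_ord_widen_cond n predT (fun k => y k * r k) mn) in h.
move/(_ _ k (leq_trans km mn)); rewrite km; apply; rewrite -[RHS]h [RHS]big_mkcond.
by apply: eq_bigr => i _ /=; case: ifP => //; rewrite mulr0.
Qed.

Lemma right_indep_sub n y e f : subidem e f ->
  right_indep n y e -> right_indep n (fun k => y k * f) f.
Proof.
move=> [ff ef fe] [ee ye ind]; split=> // [k _|r h k kn]; first by rewrite -mulrA ff.
rewrite -ef -mulrA; apply: (ind (fun k => f * r k)) => //.
by rewrite -[RHS]h; apply: eq_bigr => i _; rewrite mulrA.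
Qed.

Hypothesis reg : regular_ring R.

(** A Gram-Schmidt step: [P] removes the components along the first [n] vectors, [P * y n] stays
    injective on [e R] and thus has a left inverse, and the earlier functionals are corrected so as
    to vanish on [y n]. *)
Lemma right_indep_dual n y e : right_indep n y e ->
  exists psi : nat -> R, (forall l, e * psi l = psi l) /\
    forall k l, (k < n)%N -> (l < n)%N -> psi l * y k = e *+ (k == l).
Proof.
elim: n => [_|n IH ind_n].
  by exists (fun=> 0); split=> [l|k l]; rewrite ?mulr0 ?ltn0.
have [psi [epsi psiE]] := IH (right_indep_widen (leqnSn n) ind_n).
have [ee ye ind] := ind_n.
pose P := 1 - \sum_(l < n) y l * psi l.
have Py k : (k < n)%N -> P * y k = 0.
  move=> kn; rewrite mulrBl mul1r mulr_suml (bigD1 (Ordinal kn)) //= -mulrA.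
  rewrite psiE // eqxx mulr1n ye ?ltnS 1?ltnW // big1 ?addr0 ?subrr // => i ik.
  rewrite -mulrA psiE // (_ : (k == i) = false) ?mulr0 //.
  by apply/negbTE; rewrite eq_sym; apply: contra ik => /eqP ik; exact/eqP/val_inj.
have [w ywy] := reg (P * y n).
have Pye : P * y n * e = P * y n by rewrite -mulrA ye.
have inj r : P * y n * r = 0 -> e * r = 0.
  move=> h; have := ind (fun k => if (k == n)%N then r else - (psi k * y n * r)).
  move=> /(_ _ n (ltnSn n)); rewrite eqxx; apply.
  rewrite big_ord_recr /= eqxx -[RHS]h /P mulrBl mul1r mulrBl addrC; congr (_ + _).
  rewrite !mulr_suml -sumrN; apply: eq_bigr => i _.
  by rewrite ltn_eqF // mulrN !mulrA.
have ewP : e * w * (P * y n) = e.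
  have : e * (w * (P * y n) - e) = 0.
    by apply: inj; rewrite mulrBr mulrA ywy Pye subrr.
  by rewrite mulrBr ee mulrA => /eqP; rewrite subr_eq0 => /eqP.
pose psin := e * w * P.
have psinn : psin * y n = e by rewrite /psin -mulrA.
have psink k : (k < n)%N -> psin * y k = 0 by move=> kn; rewrite /psin -mulrA Py ?mulr0.
have epsin : e * psin = psin by rewrite /psin !mulrA ee.
clearbody psin.
exists (fun l => if (l == n)%N then psin else psi l - psi l * y n * psin); split.
  by move=> l; case: eqP => // _; rewrite mulrBr !mulrA epsi.
move=> k l; rewrite (ltnS k) (ltnS l) (leq_eqVlt k) (leq_eqVlt l).
case: (altP (l =P n)) => [->|ln] /=; case: (altP (k =P n)) => [->|kn] //=.
- by move=> kn' _; rewrite psink.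
- move=> _ ln'; rewrite mulrBl -[_ * psin * _]mulrA psinn -[_ * _ * e]mulrA.
  by rewrite ye // subrr eq_sym (negbTE ln).
- by move=> kn' ln'; rewrite mulrBl -[_ * psin * _]mulrA psink // mulr0 subr0 psiE.
Qed.

End RightIndependence.

(** * Polynomials in [a] and independence of its powers *)

Section Evaluation.
Variables (K : fieldType) (R : nzRingType) (iota : {rmorphism K -> R}).
Hypothesis iotaC : forall k x, iota k * x = x * iota k.
Variable a : R.
Implicit Types (p q : {poly K}) (P Q : {poly R}).

Lemma eval_comm : commr_rmorph iota a.
Proof. by move=> k; exact/esym/iotaC. Qed.

Local Notation ev := (horner_morph eval_comm).

Lemma evX k : ev 'X^k = a ^+ k.
Proof. by rewrite rmorphXn /= horner_morphX. Qed.

Lemma evE p n : (size p <= n)%N -> ev p = \sum_(k < n) iota p`_k * a ^+ k.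
Proof.
move=> pn; rewrite {1}(_ : p = \sum_(k < n) (p`_k)%:P * 'X^k).
  by rewrite rmorph_sum; apply: eq_bigr => k _; rewrite rmorphM /= horner_morphC evX.
rewrite -{1}(take_poly_id pn) /take_poly poly_def.
by apply: eq_bigr => k _; rewrite mul_polyC.
Qed.

Lemma ev_comm p q : ev p * ev q = ev q * ev p.
Proof. by rewrite -!rmorphM mulrC. Qed.

Lemma ev_commX p k : ev p * a ^+ k = a ^+ k * ev p.
Proof. by rewrite -evX ev_comm. Qed.

(** The coefficients act on the right of [x] and ['X] acts as left multiplication by [a], so a
    relation among the [a ^+ k * x] is a polynomial [P] with [act P x = 0]. *)
Definition act (P : {poly R}) (x : R) : R := \sum_(k < size P) a ^+ k * x * P`_k.

Lemma act_widen P x n : (size P <= n)%N -> act P x = \sum_(k < n) a ^+ k * x * P`_k.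
Proof.
move=> Pn; rewrite /act (big_ord_widen n (fun k => a ^+ k * x * P`_k) Pn) big_mkcond.
apply: eq_bigr => i _; case: ltnP => // h.
by rewrite nth_default ?mulr0.
Qed.

Lemma actD P Q x : act (P + Q) x = act P x + act Q x.
Proof.
pose n := maxn (size P) (size Q).
rewrite !(@act_widen _ _ n) ?leq_maxl ?leq_maxr ?size_polyD // -big_split.
by apply: eq_bigr => i _; rewrite coefD mulrDr.
Qed.

Lemma actMX P x : act ('X * P) x = act P (a * x).
Proof.
rewrite (@act_widen _ _ (size P).+1); last first.
  by apply: (leq_trans (size_polyMleq _ _)); rewrite size_polyX.
rewrite big_ord_recl coefXM /= mulr0 add0r; apply: eq_bigr => i _.
by rewrite /bump /= add1n coefXM exprSr mulrA.
Qed.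

Lemma actMC k P x : act ((iota k)%:P * P) x = act P (iota k * x).
Proof.
rewrite (@act_widen _ _ (size P)); last first.
  by rewrite mul_polyC size_scale_leq.
by apply: eq_bigr => i _; rewrite coefCM iotaC !mulrA.
Qed.

Lemma actM q P x : act (map_poly iota q * P) x = act P (ev q * x).
Proof.
elim/poly_ind: q P x => [|q c IH] P x.
  by rewrite !rmorph0 !mul0r /act size_poly0 big_ord0 big1 // => i _; rewrite mulr0 mul0r.
rewrite rmorphD rmorphM /= map_polyX map_polyC mulrDl -mulrA actD IH actMX actMC.
rewrite rmorphD rmorphM /= horner_morphX horner_morphC.
have -> := ev_commX q 1; rewrite expr1 /act -big_split; apply: eq_bigr => i _ /=.
by rewrite -mulrDl -mulrDr [in RHS]mulrDl mulrA.
Qed.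

Definition powers_indep n x e : Prop := right_indep n (fun k => a ^+ k * x) e.

(** In this form independence is accessible to division by a monic polynomial. *)
Lemma powers_indepP n x e : powers_indep n x e <->
  [/\ e * e = e, forall k, (k < n)%N -> a ^+ k * x * e = a ^+ k * x &
    forall P, (size P <= n)%N -> act P x = 0 -> e%:P * P = 0].
Proof.
split=> -[ee xe ind]; split=> //.
  move=> P Pn; rewrite (act_widen _ Pn) => /ind h; apply/polyP => k.
  rewrite coefCM coef0; have [/h //|nk] := ltnP k n.
  by rewrite nth_default ?mulr0 // (leq_trans Pn).
move=> r h k kn; have := ind (\poly_(i < n) r i) (size_poly _ _).
rewrite (act_widen _ (size_poly _ _)) => /(_ _)/polyP/(_ k).
rewrite coefCM coef_poly kn coef0; apply; rewrite -[RHS]h; apply: eq_bigr => i _.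
by rewrite coef_poly ltn_ord.
Qed.

Hypothesis reg : regular_ring R.
Hypothesis iota_surj : forall z, (forall x, z * x = x * z) -> exists k, iota k = z.
Hypothesis corner_scalar : forall e c : R, e * e = e -> e * c = c -> c * e = c ->
  (forall f, subidem e f -> c * f = f * c * f) ->
  exists2 k, (forall x, k * x = x * k) & c = k * e.

(** [P] removes the components along the first [r] powers. If it kills [a ^+ r * x], the dual
    functionals supply the coefficients [c]; otherwise the remainder [y] is injective on the
    idempotent [e * w * y], where independence gains one power. *)
Lemma powers_indep_extend r x e : powers_indep r x e -> x * e = x -> x != 0 ->
  (exists f, [/\ subidem e f, x * f != 0 & powers_indep r.+1 (x * f) f]) \/
  (exists c : nat -> R, (forall k, e * c k = c k /\ c k * e = c k) /\
     a ^+ r * x = \sum_(k < r) a ^+ k * x * c k).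
Proof.
move=> ind xe x0; have [psi [epsi psiE]] := right_indep_dual reg ind.
have [ee _ indr] := ind.
pose P := 1 - \sum_(l < r) a ^+ l * x * psi l.
have Px k : (k < r)%N -> P * (a ^+ k * x) = 0.
  move=> kr; rewrite mulrBl mul1r mulr_suml (bigD1 (Ordinal kr)) //= -[_ * psi _ * _]mulrA.
  rewrite psiE // eqxx mulr1n -[_ * _ * e]mulrA xe big1 ?addr0 ?subrr // => i ik.
  rewrite -[_ * psi _ * _]mulrA psiE // (_ : (k == i) = false) ?mulr0 //.
  by apply/negbTE; rewrite eq_sym; apply: contra ik => /eqP ik; exact/eqP/val_inj.
have [y0|y0] := eqVneq (P * (a ^+ r * x)) 0; [right|left].
  exists (fun k => psi k * (a ^+ r * x)); split=> [k|].
    by rewrite mulrA epsi -!mulrA xe.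
  move/eqP: y0; rewrite mulrBl mul1r subr_eq0 => /eqP {1}->.
  by rewrite mulr_suml; apply: eq_bigr => i _; rewrite !mulrA.
have [w ywy] := reg (P * (a ^+ r * x)).
have ye : P * (a ^+ r * x) * e = P * (a ^+ r * x) by rewrite -!mulrA xe.
clearbody P; move yE: (P * (a ^+ r * x)) y0 ywy ye => y y0 ywy ye.
exists (e * w * y).
have sub : subidem e (e * w * y).
  split; last 2 first.
  - by rewrite !mulrA ee.
  - by rewrite -!mulrA ye.
  by rewrite -[LHS]mulrA !(mulrA y) ye ywy.
have yf : y * (e * w * y) = y by rewrite !mulrA ye ywy.
split=> //.
  apply: contra_neq y0 => h.
  have -> : y = P * a ^+ r * (x * (e * w * y)) by rewrite -{1}yf -{1}yE !mulrA.
  by rewrite h mulr0.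
have [ff ef fe] := sub.
split=> // [k kr|s h]; first by rewrite -(mulrA (a ^+ k)) -(mulrA x) ff.
have sr : e * w * y * s r = 0.
  have : P * (\sum_(k < r.+1) a ^+ k * (x * (e * w * y)) * s k) = 0 by rewrite h mulr0.
  rewrite big_ord_recr /= mulrDr mulr_sumr big1 ?add0r.
    move=> h'; rewrite -mulrA.
    have -> : y * s r = P * (a ^+ r * (x * (e * w * y)) * s r).
      by rewrite -{1}yf -{1}yE !mulrA.
    by rewrite h' mulr0.
  by move=> i _; rewrite (mulrA _ x) !mulrA -(mulrA P) Px ?mul0r.
move=> k; rewrite ltnS leq_eqVlt => /orP[/eqP -> //|kr].
have := indr (fun k => e * w * y * s k); move=> /(_ _ k kr); rewrite !mulrA ee; apply.
move: h; rewrite big_ord_recr /= -[_ * _ * s r]mulrA -[_ * _ * s r]mulrA sr !mulr0 addr0 => h.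
by rewrite -[RHS]h; apply: eq_bigr => i _; rewrite !mulrA.
Qed.

Lemma powers_indep_sub r x e f : subidem e f ->
  powers_indep r x e -> powers_indep r (x * f) f.
Proof.
move=> sf /(right_indep_sub sf); congr right_indep.
by apply/funext => k; rewrite mulrA.
Qed.

Lemma irreducible_coprimep q p :
  irreducible_poly q -> p != 0 -> (size p < size q)%N -> coprimep p q.
Proof.
move=> irr p0 pq; rewrite coprimep_def; apply: contraTT pq => /irr.2.
rewrite dvdp_gcdr => /(_ isT)/eqp_size qE.
by rewrite -leqNgt -qE dvdp_leq // dvdp_gcdl.
Qed.

Lemma ev_coprime_eq0 p q x : coprimep p q -> ev p * x = 0 -> ev q * x = 0 -> x = 0.
Proof.
move/Bezout_eq1_coprimepP => [[u v] /= uv] px qx.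
rewrite -[x]mul1r -(rmorph1 ev) -uv rmorphD !rmorphM /= mulrDl -!mulrA px qx.
by rewrite !mulr0 addr0.
Qed.

(* If independence of the powers of [a] cannot be pushed beyond [r], then on every
   ideal where it holds up to [r] the coefficients expressing [a ^+ r] preserve all
   subideals, hence are scalars; so [a] satisfies there an equation of degree [r]. *)
Lemma powers_indep_irreducible q x0 r :
  irreducible_poly q -> x0 != 0 -> ev q * x0 = 0 -> (r < size q)%N ->
  exists x e s, [/\ x = x0 * s, x != 0, x * e = x & powers_indep r x e].
Proof.
move=> irr x00 qx0; elim: r => [_|r IH rq].
  have [w xwx] := reg x0; exists x0, (w * x0), 1.
  by rewrite mulr1 !mulrA; split=> //; split; rewrite // -!mulrA (mulrA x0) xwx.
have [x [e [s [xE x_neq0 xe ind]]]] := IH (ltnW rq).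
apply: contrapT => no.
have dep f : subidem e f -> exists c : nat -> R,
    (forall k, f * c k = c k /\ c k * f = c k) /\
    a ^+ r * (x * f) = \sum_(k < r) a ^+ k * (x * f) * c k.
  move=> sf; have [xf0|xf0] := eqVneq (x * f) 0.
    exists (fun=> 0); split=> [k|]; first by rewrite mulr0 mul0r.
    by rewrite xf0 mulr0 big1 // => i _; rewrite mulr0.
  have indf := powers_indep_sub sf ind; have [ff ef fe] := sf.
  case: (powers_indep_extend indf _ xf0) => //; first by rewrite -mulrA ff.
  case=> g [[gg _ _] xg0 indg]; case: no; exists (x * f * g), g, (s * f * g).
  by split=> //; [rewrite xE !mulrA|rewrite -mulrA gg].
have [ee _ indr] := ind.
have see : subidem e e by split.
have [c [ec]] := dep e see; rewrite xe => cE.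
(* Both expansions of [a ^+ r * (x * f)] must agree, so [c k * f = f * c' k], which lies in
   [f R]. *)
have cf k f : (k < r)%N -> subidem e f -> c k * f = f * c k * f.
  move=> kr sf; have [ff ef fe] := sf.
  have [c' [fc' c'E]] := dep f sf.
  have : e * (c k * f - f * c' k) = 0.
    apply: (indr (fun k => c k * f - f * c' k)) => //.
    have -> : \sum_(i < r) a ^+ i * x * (c i * f - f * c' i) =
        (\sum_(i < r) a ^+ i * x * c i) * f - \sum_(i < r) a ^+ i * (x * f) * c' i.
      by rewrite mulr_suml -sumrB; apply: eq_bigr => i _; rewrite mulrBr !mulrA.
    by rewrite -cE -c'E mulrA subrr.
  rewrite mulrBr !mulrA (ec k).1 ef => /eqP; rewrite subr_eq0 => /eqP ckf.
  by rewrite -mulrA ckf mulrA ff.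
have [l lE] : {l : nat -> K & forall k, (k < r)%N -> c k = iota (l k) * e}.
  apply: (choice (P := fun k y => (k < r)%N -> c k = iota y * e)) => k.
  have [kr|] := ltnP k r; last by exists 0.
  have [z zC ->] := corner_scalar ee (ec k).1 (ec k).2 (fun f => cf k f kr).
  by have [y <-] := iota_surj zC; exists y.
(* This nonzero [p] has smaller degree than [q], hence is coprime to it, yet [p] and [q] both
   annihilate [x]. *)
pose p := 'X^r - \poly_(k < r) l k : {poly K}.
have sp : size p = r.+1.
  by rewrite size_polyDl size_polyXn // size_polyN ltnS size_poly.
have p0 : p != 0 by rewrite -size_poly_eq0 sp.
move/eqP: x_neq0; apply; apply: (ev_coprime_eq0 (irreducible_coprimep irr p0 _)).
- by rewrite sp.
- rewrite rmorphB /= evX mulrBl cE; apply/eqP; rewrite subr_eq0; apply/eqP.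
  rewrite (evE (size_poly _ _)) mulr_suml; apply: eq_bigr => i _.
  rewrite coef_poly ltn_ord lE // [iota _ * e]iotaC mulrA -(mulrA _ x e) xe.
  by rewrite -[RHS]mulrA iotaC.
- by rewrite xE mulrA qx0 mul0r.
Qed.

Lemma map_iota_comm q P : map_poly iota q * P = P * map_poly iota q.
Proof.
elim/poly_ind: q => [|q c IH]; first by rewrite rmorph0 mul0r mulr0.
rewrite rmorphD rmorphM /= map_polyX map_polyC mulrDl mulrDr.
rewrite mulrA -IH -!mulrA -(commr_polyX P); congr (_ + _).
by apply/polyP => i; rewrite coefCM coefMC iotaC.
Qed.

Lemma ev_act p P x : ev p * act P x = act P (ev p * x).
Proof.
by rewrite mulr_sumr; apply: eq_bigr => i _; rewrite !mulrA ev_commX.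
Qed.

Lemma act0r P : act P 0 = 0.
Proof. by rewrite /act big1 // => i _; rewrite mulr0 mul0r. Qed.

Lemma act_annihilated e P x : x * e = x -> e%:P * P = 0 -> act P x = 0.
Proof.
move=> xe eP; rewrite /act big1 // => i _.
by rewrite -xe -!mulrA -coefCM eP coef0 !mulr0.
Qed.

(** Induction on the exponent. Write a relation [P] on [z] as [T * Q + S] by division by [q].
    Applying [q ^+ i.+1] at [a] kills the part of [T] and leaves [S] acting on [ev (q ^+ j) * y], so
    [e S = 0]; then [T] is a relation on [ev q * z], to which the induction hypothesis applies. *)
Lemma powers_indep_lift q j y e : q \is monic -> (1 < size q)%N ->
  ev (q ^+ j.+1) * y = 0 -> y * e = y ->
  powers_indep (size q).-1 (ev (q ^+ j) * y) e ->
  powers_indep ((size q).-1 * j.+1) y e.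
Proof.
move=> qm q1 qy ye /powers_indepP[ee _ ind].
have Qm : map_poly iota q \is monic by rewrite map_monic.
suff gen i z : (i <= j)%N -> z * e = z -> ev (q ^+ i) * z = ev (q ^+ j) * y ->
    powers_indep ((size q).-1 * i.+1) z e by exact: gen (leqnn j) ye erefl.
elim: i z => [|i IH] z ij ze zy.
  apply/powers_indepP; split=> // [k _|]; first by rewrite -mulrA ze.
  by rewrite muln1 -[z]mul1r -(rmorph1 ev) -(expr0 q) zy.
have qze : ev q * z * e = ev q * z by rewrite -mulrA ze.
have /powers_indepP[_ _ indi] : powers_indep ((size q).-1 * i.+1) (ev q * z) e.
  by apply: IH => //; [exact: ltnW|rewrite mulrA -rmorphM -exprSr].
apply/powers_indepP; split=> // [k _|P sP]; first by rewrite -mulrA ze.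
have PE := Pdiv.RingMonic.rdivp_eq Qm P.
set Q := map_poly iota q in Qm PE *.
set T := Pdiv.CommonRing.rdivp P Q in PE; set S := Pdiv.CommonRing.rmodp P Q in PE.
have sQ : size Q = size q by rewrite size_map_poly.
have sS : (size S <= (size q).-1)%N.
  rewrite -ltnS prednK ?(ltnW q1) // -sQ.
  by apply: Pdiv.CommonRing.ltn_rmodpN0; exact: monic_neq0.
have sT : (size T <= (size q).-1 * i.+1)%N.
  have [->|T0] := eqVneq T 0; first by rewrite size_poly0.
  have : (size (T * Q)%R <= (size q).-1 * i.+2)%N.
    rewrite (_ : T * Q = P - S); last by rewrite PE addrK.
    apply: (leq_trans (size_polyD _ _)); rewrite geq_max sP size_polyN.
    by rewrite (leq_trans sS) // leq_pmulr.
  rewrite size_Mmonic // sQ mulnS addnC.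
  by rewrite -[size q](prednK (ltnW q1)) addSn /= leq_add2l.
rewrite PE -map_iota_comm actD actM => actP.
have eS : e%:P * S = 0.
  apply: ind => //; rewrite -zy -ev_act.
  move/(congr1 ( *%R (ev (q ^+ i.+1)))): actP; rewrite mulr0 mulrDr.
  rewrite [X in X + _ = _ -> _]ev_act mulrA ev_comm -mulrA zy mulrA -rmorphM -exprS qy.
  by rewrite act0r add0r.
have eT : e%:P * T = 0.
  by apply: indi => //; move: actP; rewrite (act_annihilated ze eS) addr0.
by rewrite mulrDr eS addr0 map_iota_comm mulrA eT mul0r.
Qed.

End Evaluation.

(** * Maximal right ideals with independent translates *)

Section MaximalIndependentIdeal.
Variables (R : nzRingType) (a : R).
Hypothesis reg : regular_ring R.
Local Notation L := (right_principal_ideals R).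
Hypothesis cg : continuous_geometry L.

(** Two conditions in one: the sum of the [a ^+ k * I] is direct, and each [a ^+ k] is injective on
    [I]. *)
Definition indep_ideal n g (I : L) : Prop :=
  (I <= pid g)%O /\ forall y : nat -> R, (forall k, I (y k)) ->
    \sum_(k < n) a ^+ k * y k = 0 -> forall k, (k < n)%N -> y k = 0.

Lemma power_span_ideal m : {B : L -> L & forall I z, B I z <->
  exists2 y : nat -> R, forall k, I (y k) & z = \sum_(k < m) a ^+ k * y k}.
Proof.
apply: (choice (P := fun (I M : L) => forall z, M z <->
  exists2 y : nat -> R, forall k, I (y k) & z = \sum_(k < m) a ^+ k * y k)) => I.
elim: m => [|m [M MP]].
  exists (pid 0) => z; split=> [/pid0P ->|[y _ ->]]; last first.
    by rewrite big_ord0; exact/pid0P.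
  by exists (fun=> 0); rewrite ?big_ord0 // => k; exact: ideal0.
have [J JP] := image_ideal (a ^+ m) I; have [M' M'P] := join_ideal reg M J.
exists M' => z; rewrite M'P; split.
  case=> u [v [/MP[y Iy ->] /JP[w Iw ->] ->]].
  exists (fun k => if (k == m)%N then w else y k) => [k|]; first by case: ifP.
  rewrite big_ord_recr /= eqxx; congr (_ + _); apply: eq_bigr => i _.
  by rewrite ltn_eqF.
case=> y Iy ->; rewrite big_ord_recr /=.
exists (\sum_(k < m) a ^+ k * y k), (a ^+ m * y m); split=> //.
  by apply/MP; exists y.
by apply/JP; exists (y m).
Qed.

(** By induction on the number of powers it suffices that [a ^+ m * S] meets the sum of the lower
    translates of [S] trivially. This holds along the chain and passes to [S] by [chain_disjoint];
    preimages being principal, translates of [S] lie below every upper bound of the translates of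
    the chain. *)
Lemma indep_ideal_sup n g (C : set L) (S : L) :
  (forall I, C I -> indep_ideal n g I) ->
  total_on C (fun u v => (u <= v)%O) -> (exists I, C I) ->
  (forall I, C I -> (I <= S)%O) ->
  (forall U, (forall I, C I -> (I <= U)%O) -> (S <= U)%O) -> indep_ideal n g S.
Proof.
move=> ind tot [I0 CI0] ubS lubS; split; first by apply: lubS => I /ind[].
have inj m z : (m < n)%N -> S z -> a ^+ m * z = 0 -> z = 0.
  move=> mn Sz mz; have [N NP] := rann_ideal reg (a ^+ m).
  apply: (@chain_disjoint _ _ C id (fun=> N) S N cg) => //.
  - by move=> s t Cs Ct; case: (tot _ _ Cs Ct); [left|right].
  - move=> I CI w Iw /NP mw.
    have := (ind _ CI).2 (fun k => if (k == m)%N then w else 0).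
    move=> /(_ _ _ m mn); rewrite eqxx; apply.
      by move=> k; case: ifP => // _; exact: ideal0.
    rewrite big1 // => i _; case: eqP => [->//|_]; by rewrite mulr0.
  - by move=> U' h'; exact: h' CI0.
  - exact/NP.
have mulS m (U : L) : (forall I, C I -> forall z, I z -> U (a ^+ m * z)) ->
    forall z, S z -> U (a ^+ m * z).
  move=> h z; have [J JP] := preimage_ideal reg (a ^+ m) U.
  have /ideal_leP SJ : (S <= J)%O.
    by apply: lubS => I CI; apply/ideal_leP => w Iw; apply/JP; exact: h Iw.
  by move/SJ/JP.
suff gen m (y : nat -> R) : (m <= n)%N -> (forall k, S (y k)) ->
    \sum_(k < m) a ^+ k * y k = 0 -> forall k, (k < m)%N -> y k = 0.
  by move=> y; exact: gen.
elim: m => // m IH mn Sy; rewrite big_ord_recr /= => sum0.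
have [A AP] : {A : L -> L & forall I z, A I z <-> exists2 w, I w & z = a ^+ m * w}.
  apply: (choice (P := fun (I M : L) => forall z, M z <-> _)) => I.
  exact: image_ideal.
have [B BP] := power_span_ideal m.
have ym : y m = 0.
  apply: (inj m _ mn) => //.
  apply: (@chain_disjoint _ _ C A B (A S) (B S) cg).
  - have mono I J : (I <= J)%O -> (A I <= A J)%O /\ (B I <= B J)%O.
      move/ideal_leP => IJ; split; apply/ideal_leP => z.
        by case/AP=> w /IJ Jw ->; apply/AP; exists w.
      by case/BP=> w Iw ->; apply/BP; exists w => // k; exact: IJ.
    by move=> s t Cs Ct; case: (tot _ _ Cs Ct) => /mono; [left|right].
  - move=> I CI z /AP[w Iw ->] /BP[v Iv mw].
    (* The relation has [m.+1] terms and is padded with zeros to length [n]. *)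
    have := (ind _ CI).2 (fun k => if (k == m)%N then w else
                                   if (k < m)%N then - v k else 0).
    move=> /(_ _ _ m mn); rewrite eqxx => ->; first by rewrite mulr0.
      move=> k; case: ifP => // _; case: ifP => // _; last exact: ideal0.
      by rewrite -mulrN1; exact: idealM.
    rewrite -(big_mkord predT (fun k => a ^+ k * (if (k == m)%N then w else
                                   if (k < m)%N then - v k else 0))).
    rewrite (big_cat_nat _ mn) //= big_nat_recr //= [X in _ + X]big_nat_cond.
    rewrite [X in _ + X]big1 ?addr0 ?eqxx => [|k]; last first.
      rewrite andbT => /andP[mk _]; rewrite gtn_eqF // ltnNge ltnW //; by rewrite mulr0.
    rewrite big_mkord mw -big_split big1 //= => i _.
    by rewrite ltn_ord ltn_eqF // mulrN addrC subrr.
  - move=> U h; apply/ideal_leP => z /AP[w Sw ->]; apply: mulS Sw => I CI v Iv.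
    by have /ideal_leP := h _ CI; apply; apply/AP; exists v.
  - move=> U h; apply/ideal_leP => z /BP[w Sw ->]; apply: ideal_sum => k _.
    apply: mulS (Sw k) => I CI v Iv; have /ideal_leP := h _ CI; apply; apply/BP.
    exists (fun i : nat => if (i == k :> nat) then v else 0).
      by move=> i; case: ifP => // _; exact: ideal0.
    rewrite (bigD1 k) //= eqxx big1 ?addr0 // => i ik; case: eqP => [/val_inj ii|_].
      by rewrite ii eqxx in ik.
    by rewrite mulr0.
  - by apply/AP; exists (y m).
  - apply/BP; exists (fun k => - y k) => [k|].
      by rewrite -mulrN1; exact: idealM.
    move/eqP: sum0; rewrite addrC addr_eq0 => /eqP ->.
    by rewrite -sumrN; apply: eq_bigr => i _; rewrite mulrN.
move=> k; rewrite ltnS leq_eqVlt => /orP[/eqP -> //|].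
apply: IH => //; first exact: ltnW.
by move: sum0; rewrite ym mulr0 addr0.
Qed.

Lemma indep_ideal_maximal n g : exists I, indep_ideal n g I /\
  forall J, indep_ideal n g J -> (I <= J)%O -> J = I.
Proof.
apply: maximal_ideal_exists => //; last exact: indep_ideal_sup.
by split=> [|y y0 _ k _]; [apply/pid_leP; exact: ideal0 | exact/pid0P].
Qed.
End MaximalIndependentIdeal.

(** * Matrix units of companion blocks *)

Section MatrixUnits.
Variable R : nzRingType.

(** Units of a product of matrix algebras with identity [g]. Indices are plain naturals, constrained
    only below [n i], so blocks of different sizes need no casts. *)
Record matrix_units (I : finType) (n : I -> nat) (E : I -> nat -> nat -> R)
    (g : R) : Prop := {
  matrix_unitsM : forall i j k l k' l', (k < n i)%N -> (l < n i)%N ->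
    (k' < n j)%N -> (l' < n j)%N ->
    E i k l * E j k' l' = if (i == j) && (l == k') then E i k l' else 0;
  matrix_units_sum : \sum_i \sum_(k < n i) E i k k = g;
  matrix_units_size : forall i, (0 < n i)%N;
  matrix_units_neq0 : forall i, E i 0%N 0%N != 0
}.

Section Unit.
Variables (I : finType) (n : I -> nat) (E : I -> nat -> nat -> R) (g : R).
Hypothesis mu : matrix_units n E g.

Lemma matrix_units_unitr i k l : (k < n i)%N -> (l < n i)%N -> E i k l * g = E i k l.
Proof.
move=> kn ln; rewrite -(matrix_units_sum mu) mulr_sumr (bigD1 i) //=.
rewrite mulr_sumr (bigD1 (Ordinal ln)) //= (matrix_unitsM mu) // !eqxx.
rewrite big1 ?addr0 ?big1 ?addr0 // => [j ji|k' k'l]; last first.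
  rewrite (matrix_unitsM mu) // eqxx /= ifN //.
  by apply: contra k'l => /eqP h; exact/eqP/val_inj.
rewrite mulr_sumr big1 // => k' _.
by rewrite (matrix_unitsM mu) // eq_sym (negbTE ji).
Qed.

Lemma matrix_units_unitl i k l : (k < n i)%N -> (l < n i)%N -> g * E i k l = E i k l.
Proof.
move=> kn ln; rewrite -(matrix_units_sum mu) mulr_suml (bigD1 i) //=.
rewrite mulr_suml (bigD1 (Ordinal kn)) //= (matrix_unitsM mu) // !eqxx.
rewrite big1 ?addr0 ?big1 ?addr0 // => [j ji|k' k'l]; last first.
  by rewrite (matrix_unitsM mu) // eqxx /= ifN //.
rewrite mulr_suml big1 // => k' _.
by rewrite (matrix_unitsM mu) // (negbTE ji).
Qed.
End Unit.

Section Union.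
Variables (I1 I2 : finType) (n1 : I1 -> nat) (n2 : I2 -> nat).
Variables (E1 : I1 -> nat -> nat -> R) (E2 : I2 -> nat -> nat -> R) (g1 g2 : R).

Definition sum_case (T : Type) (f1 : I1 -> T) (f2 : I2 -> T) (i : I1 + I2) : T :=
  match i with inl i => f1 i | inr i => f2 i end.

Lemma matrix_unitsU : g1 * g2 = 0 -> g2 * g1 = 0 ->
  matrix_units n1 E1 g1 -> matrix_units n2 E2 g2 ->
  matrix_units (sum_case n1 n2) (sum_case E1 E2) (g1 + g2).
Proof.
move=> g12 g21 mu1 mu2; split.
- move=> [i|i] [j|j] k l k' l' /= h1 h2 h3 h4.
  + exact: (matrix_unitsM mu1).
  + rewrite -(matrix_units_unitr mu1) // -(matrix_units_unitl mu2) //.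
    by rewrite -mulrA (mulrA g1) g12 mul0r mulr0.
  + rewrite -(matrix_units_unitr mu2) // -(matrix_units_unitl mu1) //.
    by rewrite -mulrA (mulrA g2) g21 mul0r mulr0.
  + exact: (matrix_unitsM mu2).
- by rewrite big_sumType /= (matrix_units_sum mu1) (matrix_units_sum mu2).
- by case=> i; [exact: (matrix_units_size mu1)|exact: (matrix_units_size mu2)].
- by case=> i; [exact: (matrix_units_neq0 mu1)|exact: (matrix_units_neq0 mu2)].
Qed.
End Union.
End MatrixUnits.

(** * Companion blocks *)

Section Blocks.
Variables (K : fieldType) (R : nzRingType) (iota : {rmorphism K -> R}).
Hypothesis iotaC : forall k x, iota k * x = x * iota k.
Variable a : R.
Implicit Types (p q : {poly K}) (g x e phi : R).
Local Notation ev := (horner_morph (eval_comm iotaC a)).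

Definition matricial_on g : Prop :=
  exists (I : finType) (n : I -> nat) (E : I -> nat -> nat -> R)
    (c : I -> nat -> nat -> K), matrix_units n E g /\
    a * g = \sum_i \sum_(k < n i) \sum_(l < n i) iota (c i k l) * E i k l.

Lemma matricial_on0 : matricial_on 0.
Proof.
exists void, (fun=> 0%N), (fun _ _ _ => 0), (fun _ _ _ => 0).
split; last by rewrite mulr0 big_pred0 //; case.
by split=> [[]||[]|[]] //; rewrite big_pred0 //; case.
Qed.

Lemma matricial_onD g1 g2 : g1 * g2 = 0 -> g2 * g1 = 0 ->
  matricial_on g1 -> matricial_on g2 -> matricial_on (g1 + g2).
Proof.
move=> g12 g21 [I1 [n1 [E1 [c1 [mu1 aE1]]]]] [I2 [n2 [E2 [c2 [mu2 aE2]]]]].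
exists (I1 + I2)%type, (sum_case n1 n2), (sum_case E1 E2), (sum_case c1 c2).
split; first exact: matrix_unitsU.
by rewrite big_sumType /= mulrDr aE1 aE2.
Qed.

Section Companion.
Variables (p : {poly K}) (n : nat) (g x e phi : R).
Hypotheses (p_monic : p \is monic) (size_p : size p = n.+1) (n_gt0 : (0 < n)%N).
Hypotheses (pg : ev p * g = 0) (gx : g * x = x) (phig : phi * g = phi).
Hypotheses (ephi : e * phi = phi) (xe : x * e = x).
Hypothesis ga : g * a = a * g.
Hypothesis phix : forall k, (k < n)%N -> phi * (a ^+ k * x) = e *+ (k == n.-1).

Local Notation h l := (ev (drop_poly l.+1 p)).

(** [phi] reads off the coefficient of degree [n.-1] of a polynomial in [a] applied to [x]. *)
Lemma companion_form (f : {poly K}) :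
  (size f <= n)%N -> phi * (ev f * x) = iota f`_n.-1 * e.
Proof.
move=> fn; rewrite (evE _ _ fn) mulr_suml mulr_sumr.
have n1 : (n.-1 < n)%N by rewrite prednK.
rewrite (bigD1 (Ordinal n1)) //= big1 ?addr0 => [|i i_n].
  by rewrite -(mulrA (iota _) (a ^+ _)) mulrA -iotaC -mulrA phix // eqxx.
rewrite -(mulrA (iota _) (a ^+ _)) mulrA -iotaC -mulrA phix //.
rewrite (_ : (i == n.-1 :> nat) = false) ?mulr0 //.
by apply/negbTE; apply: contra i_n => /eqP h; exact/eqP/val_inj.
Qed.

Lemma lead_p : p`_n = 1.
Proof. by have /eqP := p_monic; rewrite lead_coefE size_p. Qed.

Lemma ev_px : ev p * x = 0.
Proof. by rewrite -gx mulrA pg mul0r. Qed.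

(* The Horner polynomials [drop_poly l.+1 p] form the basis dual to the powers of
   ['X] for the form on [K['X]/(p)] reading off the coefficient of degree [n.-1]. *)
Lemma horner_dual k l : (k < n)%N -> (l < n)%N ->
  phi * h l * (a ^+ k * x) = e *+ (k == l).
Proof.
move=> kn ln; rewrite -mulrA [h l * _]mulrA -(evX iotaC) -rmorphM.
(* For [k <= l] the product has degree below [n], and the coefficient read off is that of [p] in
   degree [n + (l - k)]: 1 if [k = l], else 0. *)
have [kl|lk] := leqP k l.
  rewrite companion_form; last first.
    rewrite (leq_trans (size_polyMleq _ _)) // size_drop_poly size_polyXn size_p.
    by rewrite subSS addnS /= -(subnK (ltnW ln)) addnK leq_add2l.
  rewrite coefMXn coef_drop_poly ltnNge -ltnS prednK // kn /=.
  have -> : (n.-1 - k + l.+1 = n + (l - k))%N.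
    have kn1 : (k <= n.-1)%N by rewrite -ltnS prednK.
    by rewrite -{1}(subnKC kl) addnS addnA subnK // -addSn prednK.
  have [->|kl'] := eqVneq k l; first by rewrite subnn addn0 lead_p rmorph1 mul1r.
  rewrite nth_default ?rmorph0 ?mul0r // size_p -addn1 leq_add2l subn_gt0.
  by rewrite ltn_neqAle kl' kl.
(* For [l < k] reduction modulo [p] leaves a polynomial of degree below [k], hence below [n.-1]
   after the shift by [l.+1]. *)
have -> : drop_poly l.+1 p * 'X^k =
    'X^(k - l.+1) * p - take_poly l.+1 p * 'X^(k - l.+1).
  rewrite -{2}(poly_take_drop l.+1 p) mulrDr mulrC [take_poly _ _ * _]mulrC addrC addKr.
  by rewrite mulrA [_ * drop_poly _ _]mulrC -mulrA -exprD subnK // mulrC.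
rewrite rmorphB rmorphM /= mulrBl -mulrA ev_px mulr0 sub0r mulrN.
rewrite companion_form; last first.
  rewrite (leq_trans (size_polyMleq _ _)) // size_polyXn addnS /=.
  by rewrite (leq_trans (leq_add (size_take_poly _ _) (leqnn _))) // subnKC // ltnW.
rewrite gtn_eqF // coefMXn coef_take_poly.
case: ifP => _; first by rewrite rmorph0 mul0r oppr0.
rewrite ifN ?rmorph0 ?mul0r ?oppr0 // -leqNgt.
by rewrite leq_subRL ?subnK // -ltnS prednK // (leq_trans _ kn) // ltnS leq_subr.
Qed.

Definition companion_unit k l := a ^+ k * x * (phi * h l).
Definition companion_idem := \sum_(k < n) companion_unit k k.

Lemma companion_unitM k l k' l' :
  (k < n)%N -> (l < n)%N -> (k' < n)%N -> (l' < n)%N ->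
  companion_unit k l * companion_unit k' l' =
  if l == k' then companion_unit k l' else 0.
Proof.
move=> kn ln k'n l'n; rewrite /companion_unit mulrA -[X in X * _ = _]mulrA.
rewrite horner_dual // eq_sym; case: eqP => _; last by rewrite mulr0n mulr0 mul0r.
by rewrite mulr1n -!mulrA [e * _]mulrA ephi.
Qed.

Lemma power_reduce : a ^+ n * x = - \sum_(k < n) iota p`_k * (a ^+ k * x).
Proof.
have := ev_px; rewrite (@evE K R iota iotaC a p n.+1) ?size_p // big_ord_recr /= lead_p rmorph1.
rewrite mul1r mulrDl => /eqP; rewrite addrC addr_eq0 => /eqP ->.
by rewrite mulr_suml; congr (- _); apply: eq_bigr => k _; rewrite mulrA.
Qed.

Lemma companion_shift : a * companion_idem =
  \sum_(k < n) a ^+ k.+1 * x * (phi * h k).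
Proof. by rewrite mulr_sumr; apply: eq_bigr => k _; rewrite !mulrA -exprS. Qed.

Lemma companion_shift_expand : a * companion_idem =
  \sum_(k < n) \sum_(l < n)
    iota ((k == l.+1 :> nat)%:R - (l == n.-1 :> nat)%:R * p`_k) * companion_unit k l.
Proof.
rewrite companion_shift exchange_big /=; apply: eq_bigr => l _.
under eq_bigr do rewrite rmorphB rmorphM !rmorph_nat mulrBl -mulrA.
rewrite sumrB -mulr_sumr; have [lE|ln] := eqVneq (l : nat) n.-1.
  rewrite mul1r big1 ?sub0r => [|k _]; last first.
    by rewrite lE prednK // ltn_eqF // mul0r.
  rewrite lE prednK // power_reduce mulNr mulr_suml; congr (- _).
  by apply: eq_bigr => k _; rewrite /companion_unit prednK // !mulrA.
rewrite mul0r subr0.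
have ln' : (l.+1 < n)%N.
  by rewrite ltn_neqAle ltn_ord andbT; apply: contra_neq ln => /(congr1 predn).
rewrite (bigD1 (Ordinal ln')) //= eqxx mul1r big1 ?addr0 // => k kl.
rewrite (_ : (k == l.+1 :> nat) = false) ?mul0r //.
by apply/negbTE; apply: contra kl => /eqP h; exact/eqP/val_inj.
Qed.

Lemma g_comm_ev (f : {poly K}) : g * ev f = ev f * g.
Proof.
elim/poly_ind: f => [|f c IH]; first by rewrite rmorph0 mulr0 mul0r.
rewrite rmorphD rmorphM /= horner_morphX horner_morphC mulrDr mulrDl iotaC.
by rewrite mulrA IH -!mulrA ga.
Qed.

Lemma phip : phi * ev p = 0.
Proof. by rewrite -phig -mulrA g_comm_ev pg mulr0. Qed.

(** With [t] as below, [a * companion_idem] is the sum of [t 1] to [t n]. Horner's recursion and the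
    reduction of [a ^+ n * x] turn [companion_idem * a] into the sum of [t 0] to [t n], and
    [t 0 = 0] because [phi * ev p = 0]. *)
Lemma companion_idemC : companion_idem * a = a * companion_idem.
Proof.
pose t k := a ^+ k * x * (phi * ev (drop_poly k p)).
have dropS k : ev (drop_poly k.+1 p) * a = ev (drop_poly k p) - iota p`_k.
  have -> : drop_poly k p = drop_poly k.+1 p * 'X + (p`_k)%:P.
    apply/polyP => -[|i]; rewrite coefD coefMX coefC !coef_drop_poly /= ?add0r //.
    by rewrite addr0 addSnnS.
  by rewrite rmorphD rmorphM /= horner_morphX horner_morphC addrK.
have t0 : t 0%N = 0.
  rewrite /t (_ : drop_poly 0 p = p) ?phip ?mulr0 //.
  by apply/polyP => i; rewrite coef_drop_poly addn0.
have tn : t n = a ^+ n * x * phi.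
  rewrite /t (_ : drop_poly n p = 1) ?rmorph1 ?mulr1 //; apply/polyP => -[|i].
    by rewrite coef_drop_poly lead_p coef1.
  by rewrite coef_drop_poly coef1 nth_default // size_p addSn ltnS leq_addl.
have -> : a * companion_idem = \sum_(k < n) t k.+1 by rewrite companion_shift.
have -> : companion_idem * a = \sum_(k < n) t k + t n.
  have -> : companion_idem * a =
      \sum_(k < n) (t k - iota p`_k * (a ^+ k * x) * phi).
    rewrite [LHS]mulr_suml; apply: eq_bigr => k _.
    rewrite /companion_unit /t -[LHS]mulrA -(mulrA phi) dropS !mulrBr; congr (_ - _).
    by rewrite mulrA -iotaC !mulrA.
  by rewrite sumrB tn power_reduce mulNr mulr_suml.
transitivity (\sum_(k < n.+1) t k); first by rewrite big_ord_recr.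
by rewrite big_ord_recl t0 add0r.
Qed.

Lemma companion_idem_gl : g * companion_idem = companion_idem.
Proof.
rewrite mulr_sumr; apply: eq_bigr => k _.
by rewrite /companion_unit !mulrA -[a ^+ k](evX iotaC) g_comm_ev -(mulrA _ g) gx.
Qed.

Lemma companion_idem_gr : companion_idem * g = companion_idem.
Proof.
rewrite mulr_suml; apply: eq_bigr => k _.
by rewrite /companion_unit -!mulrA -g_comm_ev (mulrA phi) phig.
Qed.

Lemma companion_idemx : companion_idem * x = x.
Proof.
rewrite mulr_suml (bigD1 (Ordinal n_gt0)) //= big1 ?addr0 => [|k k0].
  have := horner_dual n_gt0 n_gt0; rewrite expr0 mul1r eqxx mulr1n => h0.
  by rewrite /companion_unit expr0 mul1r -mulrA h0.
have := horner_dual n_gt0 (ltn_ord k); rewrite expr0 mul1r => hk.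
rewrite /companion_unit -mulrA hk (_ : (0%N == k) = false) ?mulr0 //.
by apply/negbTE; apply: contra k0 => /eqP kE; apply/eqP/val_inj; rewrite /= -kE.
Qed.

Lemma companion_idemK : companion_idem * companion_idem = companion_idem.
Proof.
rewrite [LHS]mulr_suml; apply: eq_bigr => k _.
rewrite mulr_sumr (bigD1 k) //= companion_unitM // eqxx big1 ?addr0 // => l lk.
by rewrite companion_unitM // ifN // eq_sym; apply: contra lk => /eqP h; apply/eqP/val_inj.
Qed.

Lemma companion_matricial : e != 0 -> matricial_on companion_idem.
Proof.
move=> e0; exists unit, (fun=> n), (fun=> companion_unit).
exists (fun _ k l => (k == l.+1)%:R - (l == n.-1)%:R * p`_k).
split; last by rewrite companion_shift_expand (big_pred1 tt) // => -[].
split=> //.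
- by move=> [] [] k l k' l' kn ln k'n l'n; rewrite companion_unitM.
- by rewrite (big_pred1 tt) // => -[].
move=> _; apply: contra_neq e0 => h0.
have := horner_dual n_gt0 n_gt0; rewrite expr0 mul1r eqxx mulr1n => he.
have : phi * h 0 * (companion_unit 0 0 * x) = 0 by rewrite h0 mul0r mulr0.
rewrite /companion_unit expr0 mul1r -(mulrA x) he xe he //.
Qed.

End Companion.
End Blocks.

(** * Primary decomposition *)

Section IrreducibleFactor.
Variable K : fieldType.
Implicit Types p q : {poly K}.

Lemma irreducible_factor p : (1 < size p)%N ->
  exists q, [/\ q \is monic, irreducible_poly q & q %| p].
Proof.
move=> p1; pose P n := `[< exists q, [/\ size q = n, (1 < n)%N & q %| p] >].
have exP : exists n, P n by exists (size p); apply/asboolP; exists p.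
case: (ex_minnP exP) => n /asboolP[q [sq n1 qp]] nmin.
have q0 : q != 0 by rewrite -size_poly_gt0 sq ltnW.
have p0 : p != 0 by rewrite -size_poly_gt0 ltnW.
have lq : lead_coef q != 0 by rewrite lead_coef_eq0.
have lq' : (lead_coef q)^-1 != 0 by rewrite invr_eq0.
exists ((lead_coef q)^-1 *: q); split.
- by rewrite monicE lead_coefZ mulVf.
- split=> [|r r1]; first by rewrite size_scale // sq.
  rewrite dvdpZr // eqp_sym (eqp_ltrans (eqp_scale _ _)) // => rq.
  rewrite eqp_sym -dvdp_size_eqp // sq eqn_leq -{1}sq dvdp_leq //=.
  apply: nmin; apply/asboolP; exists r; split=> //; last exact: dvdp_trans qp.
  rewrite ltn_neqAle eq_sym r1 size_poly_gt0.
  by apply: contra_neq q0 => r0; move: rq; rewrite r0 dvd0p => /eqP.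
- by rewrite dvdpZl.
Qed.

Lemma irreducible_power_factor q p : irreducible_poly q -> p != 0 ->
  exists j p', p = q ^+ j * p' /\ coprimep q p'.
Proof.
move=> irr; have [m] := ubnP (size p); elim: m p => // m IH p pm p0.
have [/dvdpP[r pE]|nqp] := boolP (q %| p); last first.
  exists 0%N, p; rewrite expr0 mul1r; split=> //.
  rewrite coprimep_def; apply: contraNT nqp => /irr.2.
  by rewrite dvdp_gcdl => /(_ isT)/eqp_dvdl <-; exact: dvdp_gcdr.
have r0 : r != 0 by apply: contra_neq p0 => r0; rewrite pE r0 mul0r.
have q0 := irredp_neq0 irr.
have [|j [p' [rE cop]]] := IH r _ r0.
  move: pm; rewrite pE size_mul // ltnS; apply: leq_trans.
  rewrite -[size q]prednK ?size_poly_gt0 // addnS /= -addn1 leq_add2l -ltnS.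
  by rewrite prednK ?irr.1 // size_poly_gt0.
by exists j.+1, p'; rewrite pE rE exprSr mulrAC.
Qed.
End IrreducibleFactor.

(** * Splitting an algebraic element into companion blocks *)

Section Decomposition.
Variables (K : fieldType) (R : nzRingType) (iota : {rmorphism K -> R}).
Hypothesis iotaC : forall k x, iota k * x = x * iota k.
Hypothesis reg : regular_ring R.
Hypothesis cg : continuous_geometry (right_principal_ideals R).
Hypothesis iota_surj : forall z, (forall x, z * x = x * z) -> exists k, iota k = z.
Hypothesis corner_scalar : forall e c : R, e * e = e -> e * c = c -> c * e = c ->
  (forall f, subidem e f -> c * f = f * c * f) ->
  exists2 k, (forall x, k * x = x * k) & c = k * e.
Variable a : R.
Implicit Types (p q : {poly K}) (g x e phi : R).
Local Notation ev := (horner_morph (eval_comm iotaC a)).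
Local Notation matricial_on := (matricial_on iota a).

Lemma indep_ideal_block n p g x : p \is monic -> size p = n.+1 -> (0 < n)%N ->
  ev p * g = 0 -> g * g = g -> g * a = a * g -> indep_ideal a n g (pid x) ->
  exists g0, [/\ matricial_on g0, subidem g g0, g0 * a = a * g0 & g0 * x = x].
Proof.
move=> pm sp n0 pg gg ga [xg ind].
have gx : g * x = x by apply/(idem_ideal gg); exact/pid_leP.
have [->|x0] := eqVneq x 0.
  exists 0; split; [exact: matricial_on0|split| |]; by rewrite ?mulr0 ?mul0r.
have [w xwx] := reg x; pose e := w * x.
have xe : x * e = x by rewrite /e mulrA.
have e0 : e != 0 by apply: contra_neq x0 => e0; rewrite -xe e0 mulr0.
have indx : powers_indep a n x e.
  split=> [|k _|r h k kn]; first by rewrite /e -mulrA (mulrA x) xwx.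
    by rewrite -mulrA xe.
  rewrite /e -mulrA (ind (fun k => x * r k)) ?mulr0 // => [l|].
    by apply/pidP; exists (r l).
  by rewrite -[RHS]h; apply: eq_bigr => i _; rewrite mulrA.
have [psi [epsi psiE]] := right_indep_dual reg indx.
have n1 : (n.-1 < n)%N by rewrite prednK.
(* The factor [g] gives [phi * g = phi] and keeps the values on [a ^+ k * x], which [g] fixes. *)
pose phi := psi n.-1 * g.
have phix k : (k < n)%N -> phi * (a ^+ k * x) = e *+ (k == n.-1).
  move=> kn; rewrite -psiE // /phi -mulrA; congr (_ * _).
  by rewrite -(evX iotaC) mulrA (g_comm_ev iotaC ga) -mulrA gx.
have phig : phi * g = phi by rewrite /phi -mulrA gg.
have ephi : e * phi = phi by rewrite /phi mulrA epsi.
exists (companion_idem iotaC a p n x phi); split.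
- exact: (companion_matricial pm sp n0 pg gx ephi xe phix).
- split.
  + exact: (companion_idemK pm sp n0 pg gx ephi phix).
  + exact: companion_idem_gl.
  + exact: companion_idem_gr.
- exact: (companion_idemC pm sp pg gx phig ga).
- exact: (companion_idemx pm sp n0 pg gx xe phix).
Qed.

(** A maximal independent ideal [x R] gives a block [g0]. If [q ^+ j] at [a] did not vanish on the
    complement [g1], some [y] in [g1 R] would have [n] independent powers, and [x R + y R] would
    contradict maximality. So induction applies to [g1]. *)
Lemma primary_matricial q j g : q \is monic -> irreducible_poly q ->
  g * g = g -> g * a = a * g -> ev (q ^+ j) * g = 0 -> matricial_on g.
Proof.
move=> qm irr; elim: j g => [|j IH] g gg ga.
  by rewrite expr0 rmorph1 mul1r => ->; exact: matricial_on0.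
move=> qg.
have q1 : (1 < size q)%N := irr.1.
pose n := ((size q).-1 * j.+1)%N.
have d0 : (0 < (size q).-1)%N by rewrite -ltnS prednK // ltnW.
have n0 : (0 < n)%N by rewrite muln_gt0 d0.
have pm : q ^+ j.+1 \is monic by rewrite monic_exp.
have sp : size (q ^+ j.+1) = n.+1.
  by rewrite /n -size_exp prednK // size_poly_gt0 monic_neq0.
have [I [indI Imax]] := indep_ideal_maximal a reg cg n g.
have [x IE] := idealP I; rewrite IE in indI Imax.
have [g0 [mat0 [g0g0 gg0 g0g] g0a g0x]] :=
  indep_ideal_block pm sp n0 qg gg ga indI.
pose g1 := g - g0.
have g01 : g0 * g1 = 0 by rewrite mulrBr g0g g0g0 subrr.
have g10 : g1 * g0 = 0 by rewrite mulrBl gg0 g0g0 subrr.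
have gE : g = g0 + g1 by rewrite addrC subrK.
have gg1 : g * g1 = g1 by rewrite mulrBr gg gg0.
have g11 : g1 * g1 = g1 by rewrite {1}/g1 mulrBl gg1 g01 subr0.
have g1a : g1 * a = a * g1 by rewrite mulrBl mulrBr ga g0a.
have qg1 : ev (q ^+ j.+1) * g1 = 0 by rewrite -gg1 mulrA qg mul0r.
rewrite gE; apply: matricial_onD => //; apply: (IH g1 g11 g1a).
clearbody g1.
apply/eqP; apply: contraT => y0.
have qy0 : ev q * (ev (q ^+ j) * g1) = 0 by rewrite mulrA -rmorphM -exprS.
have dq : ((size q).-1 < size q)%N by rewrite prednK // ltnW.
have [z [e [s [zE z0 ze indz]]]] :=
  powers_indep_irreducible reg iota_surj corner_scalar irr y0 qy0 dq.
pose y := g1 * s * e.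
have yz : ev (q ^+ j) * y = z by rewrite /y !mulrA -zE ze.
have [ee _ _] := indz.
have ye : y * e = y by rewrite /y -mulrA ee.
have g1y : g1 * y = y by rewrite /y !mulrA g11.
have g0y : g0 * y = 0 by rewrite -g1y mulrA g01 mul0r.
have gy : g * y = y by rewrite -g1y mulrA gg1.
have qy : ev (q ^+ j.+1) * y = 0 by rewrite -g1y mulrA qg1 mul0r.
have [_ _ indy] : powers_indep a n y e.
  by apply: (powers_indep_lift (iotaC := iotaC) qm q1 qy ye); rewrite yz.
clearbody y.
have y_neq0 : y != 0 by apply: contra_neq z0 => y_eq0; rewrite -yz y_eq0 mulr0.
have g0_pow k u : g0 * (a ^+ k * u) = a ^+ k * (g0 * u).
  by rewrite -(evX iotaC) !mulrA (g_comm_ev iotaC g0a).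
have [J JP] := join_ideal reg (pid x) (pid y).
have IJ : (pid x <= J)%O.
  by apply/pid_leP/JP; exists x, 0; rewrite addr0; split=> //; [exact: pid_gen|exact: ideal0].
have Jy : J y.
  by apply/JP; exists 0, y; rewrite add0r; split=> //; [exact: ideal0|exact: pid_gen].
have indJ : indep_ideal a n g J.
  split.
    apply/ideal_leP => _ /JP[u [v [xu /pidP[r ->] ->]]]; apply/(idem_ideal gg).
    move/ideal_leP: indI.1 => /(_ _ xu)/(idem_ideal gg) gu.
    by rewrite mulrDr gu mulrA gy.
  move=> c Jc sum0.
  have [uv uvE] : {uv : nat -> R * R & forall k,
      (pid x) (uv k).1 /\ c k = (uv k).1 + y * (uv k).2}.
    apply: (choice (P := fun k (uv : R * R) =>
      (pid x) uv.1 /\ c k = uv.1 + y * uv.2)) => k.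
    by have /JP[u [_ [xu /pidP[r ->] ->]]] := Jc k; exists (u, r).
  have sumE : \sum_(k < n) a ^+ k * (uv k).1 + \sum_(k < n) a ^+ k * y * (uv k).2 = 0.
    rewrite -[RHS]sum0 -big_split; apply: eq_bigr => k _.
    by rewrite /= (uvE k).2 mulrDr mulrA.
  (* Multiplication by [g0] separates the two parts: it commutes with [a], fixes [x] and kills
     [y]. *)
  have sum1 : \sum_(k < n) a ^+ k * (uv k).1 = 0.
    transitivity (\sum_(k < n) g0 * (a ^+ k * (uv k).1)).
      apply: eq_bigr => k _; rewrite g0_pow; have /pidP[r ->] := (uvE k).1.
      by rewrite (mulrA g0) g0x.
    move/(congr1 ( *%R g0)): (sumE); rewrite mulr0 mulrDr !mulr_sumr.
    rewrite [X in _ + X]big1 ?addr0 // => k _.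
    by rewrite -mulrA g0_pow (mulrA g0) g0y mul0r mulr0.
  have u0 := indI.2 (fun k => (uv k).1) (fun k => (uvE k).1) sum1.
  move: sumE; rewrite sum1 add0r => /(indy (fun k => (uv k).2)) r0 k kn.
  by rewrite (uvE k).2 u0 // -ye -mulrA r0 // mulr0 addr0.
have JI := Imax _ indJ IJ.
move: Jy; rewrite JI => /pidP[r yE].
by move: y_neq0; rewrite yE -g0x -mulrA -yE g0y eqxx.
Qed.

(** Bezout for [q ^+ j] and [p'] splits [g] into orthogonal idempotents commuting with [a], one
    annihilated by [q ^+ j] and the other by the smaller polynomial [p']. *)
Lemma algebraic_matricial_on p g : p != 0 -> g * g = g -> g * a = a * g ->
  ev p * g = 0 -> matricial_on g.
Proof.
have [m] := ubnP (size p); elim: m p g => // m IH p g pm p0 gg ga pg.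
have [p1|p1] := leqP (size p) 1.
  have pE := size1_polyC p1; have c0 : p`_0 != 0 by rewrite -polyC_eq0 -pE.
  have cg0 : iota p`_0 * g = 0 by rewrite -(horner_morphC (eval_comm iotaC a)) -pE.
  suff -> : g = 0 by exact: matricial_on0.
  rewrite -[g]mul1r -(rmorph1 iota) -(mulVf c0) rmorphM -mulrA.
  by rewrite cg0 mulr0.
have [q [qm irr qp]] := irreducible_factor p1.
have [j [p' [pE cop]]] := irreducible_power_factor irr p0.
have := coprimep_expl j cop => /Bezout_eq1_coprimepP[[u v] /= uv].
have ev_g f f' : ev f * g * (ev f' * g) = ev (f * f') * g.
  by rewrite -mulrA [g * (_ * _)]mulrA (g_comm_ev iotaC ga) -!mulrA gg mulrA -rmorphM.
have ev_ga f : ev f * g * a = a * (ev f * g).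
  by rewrite -mulrA ga !mulrA; congr (_ * _); have := ev_commX iotaC a f 1; rewrite expr1.
have uvp : ev (u * q ^+ j * (v * p')) * g = 0.
  have -> : u * q ^+ j * (v * p') = u * v * p by rewrite pE mulrACA.
  by rewrite rmorphM -mulrA pg mulr0.
have gE : g = ev (v * p') * g + ev (u * q ^+ j) * g.
  by rewrite -mulrDl -rmorphD addrC uv rmorph1 mul1r.
rewrite gE; apply: matricial_onD.
- by rewrite ev_g mulrC uvp.
- by rewrite ev_g uvp.
- apply: (@primary_matricial q j) => //.
  + rewrite ev_g {1}(_ : v * p' = 1 - u * q ^+ j); last by rewrite -uv addrAC subrr add0r.
    by rewrite mulrBl mul1r rmorphB mulrBl uvp subr0.
  + rewrite mulrA -rmorphM.
    have -> : q ^+ j * (v * p') = v * p by rewrite pE mulrCA.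
    by rewrite rmorphM -mulrA pg mulr0.
- apply: (IH p') => //.
  + move: pm; rewrite ltnS; apply: leq_trans.
    have p'0 : p' != 0 by apply: contra_neq p0 => p'0; rewrite pE p'0 mulr0.
    have q0 : q ^+ j != 0 by rewrite expf_neq0 // irredp_neq0.
    rewrite pE size_mul // -[size (q ^+ j)]prednK ?size_poly_gt0 // size_exp addSn /=.
    rewrite -[X in (X < _)%N]add0n ltn_add2r muln_gt0 -ltnS prednK ?irr.1 /=; last first.
      by rewrite ltnW ?irr.1.
    (* If [j = 0] then [p' = p], which [q] divides, against coprimality. *)
    rewrite lt0n; apply/eqP => j0; move: qp cop; rewrite pE j0 expr0 mul1r.
    move=> /dvdp_gcd_idl/eqp_size sq; rewrite coprimep_def sq => /eqP q1.
    by have := irr.1; rewrite q1.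
  + by apply: contra_neq p0 => p'0; rewrite pE p'0 mulr0.
  + rewrite ev_g {2}(_ : u * q ^+ j = 1 - v * p'); last by rewrite -uv addrK.
    by rewrite mulrBr mulr1 rmorphB mulrBl uvp subr0.
  + rewrite mulrA -rmorphM.
    have -> : p' * (u * q ^+ j) = u * p by rewrite pE mulrC mulrA.
    by rewrite rmorphM -mulrA pg mulr0.
Qed.

End Decomposition.

(** * Matricial subalgebras *)

Section MatricialAlgebraic.
Variable K : comNzRingType.

Lemma horner_alg_morph (A B : algType K) (f : {rmorphism A -> B}) (a : A)
    (p : {poly K}) : (forall k : K, f k%:A = k%:A) -> f (horner_alg a p) = horner_alg (f a) p.
Proof.
move=> fA; elim/poly_ind: p => [|p c IH]; first by rewrite !rmorph0.
by rewrite !rmorphD !rmorphM /= !horner_algX !horner_algC IH fA.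
Qed.

Lemma horner_alg_mx n (M : 'M[K]_n.+1) (p : {poly K}) : horner_alg M p = horner_mx M p.
Proof.
elim/poly_ind: p => [|p c IH]; first by rewrite !rmorph0.
rewrite !rmorphD !rmorphM /= horner_algX horner_algC horner_mx_X horner_mx_C IH.
by rewrite scalemx1.
Qed.

(** By Cayley-Hamilton the product of the characteristic polynomials of the components annihilates
    each component. *)
Lemma matricial_algebraic (A : algType K) (a : A) :
  matricial_element a -> algebraic_element a.
Proof.
move=> [S [aS [m [n [f fbij]]]]]; pose s := Subalgebra aS.
pose p := \prod_i char_poly (f i s).
exists p; first by rewrite monic_neq0 // monic_prod // => i _; exact: char_poly_monic.
have -> : horner_alg a p = \val (horner_alg s p).
  pose v : {rmorphism subalgebra S -> A} := (\val : subalgebra S -> A).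
  have vA k : v k%:A = k%:A.
    transitivity (k *: \val (1 : subalgebra S)); last by rewrite (rmorph1 v).
    exact: linearZ.
  exact/esym/(horner_alg_morph (f := v)).
suff -> : horner_alg s p = 0 by rewrite rmorph0.
apply: (bij_inj fbij); apply: functional_extensionality_dep => i.
rewrite rmorph0 horner_alg_morph => [|k]; last first.
  by have := rmorph1 (f i) => f1; rewrite -[in RHS]f1; exact: linearZ.
rewrite horner_alg_mx /p (bigD1 i) //= rmorphM /=.
by rewrite Cayley_Hamilton mul0r.
Qed.
End MatricialAlgebraic.

(** * The algebra spanned by matrix units *)

Section MatrixUnitsSpan.
Variables (K : comNzRingType) (A : algType K) (I : finType) (n : I -> nat).
Variables (E : I -> nat -> nat -> A) (mu : matrix_units n E 1).
Hypothesis E_free : forall i (k : K), k *: E i 0%N 0%N = 0 -> k = 0.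
Variables (J : finType) (s : J -> I).
Hypothesis s_bij : bijective s.

Local Notation N j := (n (s j)).-1.

Lemma block_size j : (N j).+1 = n (s j).
Proof. by rewrite prednK // (matrix_units_size mu). Qed.

Lemma block_bound j (k : 'I_(N j).+1) : (k < n (s j))%N.
Proof. by rewrite (leq_trans (ltn_ord k)) // block_size. Qed.

Lemma block_sum j (F : nat -> A) : \sum_(k < (N j).+1) F k = \sum_(k < n (s j)) F k.
Proof. by rewrite -!(big_mkord predT F) block_size. Qed.

Definition block j (M : 'M[K]_((N j).+1)) : A := \sum_k \sum_l M k l *: E (s j) k l.

Definition blocks (M : forall j, 'M[K]_((N j).+1)) : A := \sum_j block (M j).

Lemma block_linear j a (M M' : 'M[K]_((N j).+1)) :
  block (a *: M + M') = a *: block M + block M'.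
Proof.
rewrite /block scaler_sumr -big_split; apply: eq_bigr => k _ /=.
rewrite scaler_sumr -big_split; apply: eq_bigr => l _ /=.
by rewrite !mxE scalerDl scalerA.
Qed.

Lemma blockM j (M M' : 'M[K]_((N j).+1)) : block M * block M' = block (M *m M').
Proof.
have bnd (k : 'I_(N j).+1) : (k < n (s j))%N by exact: block_bound.
rewrite /block mulr_suml; apply: eq_bigr => k _.
under [RHS]eq_bigr do rewrite mxE scaler_suml.
rewrite [RHS]exchange_big mulr_suml; apply: eq_bigr => l _ /=.
rewrite mulr_sumr (bigD1 l) //= [X in _ + X]big1 ?addr0 => [|k' k'l].
  rewrite mulr_sumr; apply: eq_bigr => l' _.
  by rewrite -scalerAl -scalerAr scalerA (matrix_unitsM mu) // !eqxx.
rewrite mulr_sumr big1 // => l' _.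
rewrite -scalerAl -scalerAr (matrix_unitsM mu) // eqxx /= ifN ?scaler0 //.
by rewrite eq_sym.
Qed.

Lemma block_orth i j (M : 'M[K]_((N i).+1)) (M' : 'M[K]_((N j).+1)) :
  i != j -> block M * block M' = 0.
Proof.
move=> ij; have bnd h (k : 'I_(N h).+1) : (k < n (s h))%N by exact: block_bound.
rewrite /block mulr_suml big1 // => k _; rewrite mulr_suml big1 // => l _.
rewrite mulr_sumr big1 // => k' _; rewrite mulr_sumr big1 // => l' _.
rewrite -scalerAl -scalerAr (matrix_unitsM mu) // (inj_eq (bij_inj s_bij)).
by rewrite (negbTE ij) !scaler0.
Qed.

Lemma blocks_linear a (M M' : forall j, 'M[K]_((N j).+1)) :
  blocks (fun j => a *: M j + M' j) = a *: blocks M + blocks M'.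
Proof.
by rewrite /blocks scaler_sumr -big_split; apply: eq_bigr => j _; exact: block_linear.
Qed.

Lemma blocksM (M M' : forall j, 'M[K]_((N j).+1)) :
  blocks (fun j => M j *m M' j) = blocks M * blocks M'.
Proof.
rewrite /blocks mulr_suml; apply: eq_bigr => j _.
rewrite mulr_sumr (bigD1 j) //= blockM big1 ?addr0 // => i ij.
by rewrite block_orth // eq_sym.
Qed.

Lemma blocks1 : blocks (fun j => 1%:M) = 1.
Proof.
rewrite -(matrix_units_sum mu) (reindex s) /=; last exact: onW_bij.
apply: eq_bigr => j _; rewrite -(block_sum j (fun k => E (s j) k k)).
apply: eq_bigr => k _; rewrite (bigD1 k) //= big1 ?addr0 => [|l lk].
  by rewrite mxE eqxx scale1r.
by rewrite mxE eq_sym (negbTE lk) scale0r.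
Qed.

(** Multiplying by [E (s j) 0 k] on the left and [E (s j) l 0] on the right isolates the entry at
    [k], [l] as a multiple of [E (s j) 0 0], and [E_free] recovers it. *)
Lemma blocks_inj (M M' : forall j, 'M[K]_((N j).+1)) :
  blocks M = blocks M' -> forall j, M j = M' j.
Proof.
move=> MM' j; apply/matrixP => k l.
have bnd (k' : 'I_(N j).+1) : (k' < n (s j))%N by exact: block_bound.
have n0 := matrix_units_size mu (s j).
have coef (P : forall j, 'M[K]_((N j).+1)) :
    E (s j) 0%N k * blocks P * E (s j) l 0%N = P j k l *: E (s j) 0%N 0%N.
  rewrite /blocks mulr_sumr mulr_suml (bigD1 j) //= [X in _ + X]big1 ?addr0 => [|i ij].
    rewrite /block mulr_sumr mulr_suml (bigD1 k) //= [X in _ + X]big1 ?addr0 => [|k' k'k].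
      rewrite mulr_sumr mulr_suml (bigD1 l) //= [X in _ + X]big1 ?addr0 => [|l' l'l].
        by rewrite -scalerAr -scalerAl !(matrix_unitsM mu) // !eqxx (matrix_unitsM mu) // !eqxx.
      rewrite -scalerAr -scalerAl (matrix_unitsM mu) // !eqxx /=.
      by rewrite (matrix_unitsM mu) // eqxx /= ifN ?scaler0.
    rewrite mulr_sumr mulr_suml big1 // => l' _.
    by rewrite -scalerAr (matrix_unitsM mu) // eqxx /= ifN 1?eq_sym // scaler0 mul0r.
  rewrite /block mulr_sumr mulr_suml big1 // => k' _.
  rewrite mulr_sumr mulr_suml big1 // => l' _.
  have bndi (h : 'I_(N i).+1) : (h < n (s i))%N by exact: block_bound.
  rewrite -scalerAr (matrix_unitsM mu) // (inj_eq (bij_inj s_bij)) eq_sym.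
  by rewrite (negbTE ij) /= scaler0 mul0r.
apply/eqP; rewrite -subr_eq0; apply/eqP/(@E_free (s j)).
by rewrite scalerBl -!coef MM' subrr.
Qed.

End MatrixUnitsSpan.

(** The subalgebra is the image of [Phi]. Coordinates are chosen preimages under [Phi]; as [Phi] is
    injective and respects the operations, they are algebra morphisms. *)
Lemma matrix_units_matricial (K : comNzRingType) (A : algType K) (I : finType)
    (n : I -> nat) (E : I -> nat -> nat -> A) (c : I -> nat -> nat -> K) (a : A) :
  matrix_units n E 1 ->
  (forall i (k : K), k *: E i 0%N 0%N = 0 -> k = 0) ->
  a = \sum_i \sum_(k < n i) \sum_(l < n i) c i k l *: E i k l ->
  matricial_element a.
Proof.
move=> mu E_free aE.
(* There is at least one block, since an empty sum of units would give [1 = 0]. *)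
have cardI : #|I|.-1.+1 = #|I|.
  rewrite prednK // lt0n; apply/eqP => I0.
  have := oner_neq0 A; rewrite -(matrix_units_sum mu) big_pred0 ?eqxx //.
  by move=> i; have := fintype0 i; rewrite I0.
pose s (j : 'I_#|I|.-1.+1) : I := enum_val (cast_ord cardI j).
have s_bij : bijective s.
  exists (fun i => cast_ord (esym cardI) (enum_rank i)) => [j|i].
    by rewrite /s enum_valK cast_ordK.
  by rewrite /s cast_ordKV enum_rankK.
pose Phi := @blocks K A I n E _ s.
have PhiL k M M' : Phi (fun j => k *: M j + M' j) = k *: Phi M + Phi M'.
  exact: blocks_linear.
have PhiM M M' : Phi (fun j => M j *m M' j) = Phi M * Phi M' by exact: blocksM.
have Phi1 : Phi (fun=> 1%:M) = 1 by exact: blocks1.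
have Phi_inj M M' : Phi M = Phi M' -> forall j, M j = M' j.
  exact: (blocks_inj mu E_free s_bij).
have [Ma aPhi] : exists M, a = Phi M.
  exists (fun j => \matrix_(k, l) c (s j) k l).
  rewrite aE (reindex s) /=; last exact: onW_bij.
  apply: eq_bigr => j _; rewrite -(block_sum mu s j (fun k =>
    \sum_(l < n (s j)) c (s j) k l *: E (s j) k l)).
  apply: eq_bigr => k _; rewrite -(block_sum mu s j (fun l => c (s j) k l *: E (s j) k l)).
  by apply: eq_bigr => l _; rewrite mxE.
clearbody Phi.
pose P : {pred A} := fun x => `[< exists M, x = Phi M >].
have PP x : reflect (exists M, x = Phi M) (x \in P) by exact: asboolP.
have P_closed : subalg_closed P.
  split.
  - by apply/PP; exists (fun=> 1%:M).
  - move=> k _ _ /PP[M ->] /PP[M' ->]; apply/PP.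
    by exists (fun j => k *: M j + M' j).
  - move=> _ _ /PP[M ->] /PP[M' ->]; apply/PP.
    by exists (fun j => M j *m M' j).
pose S : subalgClosed A := HB.pack P (GRing.isSubalgClosed.Build K A P P_closed).
exists S; split; first by apply/PP; exists Ma.
have coordsP (x : subalgebra S) : exists M, \val x = Phi M by exact/PP/(valP x).
pose coords (x : subalgebra S) := sval (cid (coordsP x)).
have coordsE x : Phi (coords x) = \val x := esym (svalP (cid (coordsP x))).
clearbody coords.
have coordsB j : {morph coords^~ j : x y / x - y}.
  move=> x y; have /Phi_inj/(_ j) <- :
      Phi (fun j => (-1) *: coords y j + coords x j) = Phi (coords (x - y)).
    by rewrite PhiL !coordsE scaleN1r addrC rmorphB.
  by rewrite scaleN1r addrC.
have coordsM j : monoid_morphism (coords^~ j).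
  split=> [|x y].
    have /Phi_inj/(_ j) <- // : Phi (fun=> 1%:M) = Phi (coords 1).
    by rewrite Phi1 coordsE rmorph1.
  have /Phi_inj/(_ j) <- // :
    Phi (fun j => coords x j *m coords y j) = Phi (coords (x * y)).
  by rewrite PhiM !coordsE rmorphM.
have coordsZ j : scalable (coords^~ j).
  move=> k x; have c0 : coords 0 j = 0 by rewrite -(subrr x) coordsB subrr.
  have /Phi_inj/(_ j) <- :
      Phi (fun j => k *: coords x j + coords 0 j) = Phi (coords (k *: x)).
    by rewrite PhiL !coordsE rmorph0 addr0 linearZ.
  by rewrite c0 addr0.
pose f j : {lrmorphism subalgebra S -> 'M[K]_((n (s j)).-1.+1)} :=
  HB.pack (coords^~ j)
    (GRing.isZmodMorphism.Build _ _ (coords^~ j) (coordsB j))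
    (GRing.isMonoidMorphism.Build _ _ (coords^~ j) (coordsM j))
    (GRing.isScalable.Build K _ _ *:%R (coords^~ j) (coordsZ j)).
exists #|I|.-1, (fun j => (n (s j)).-1), f.
have PhiS M : Phi M \in S by apply/PP; exists M.
exists (fun M => Subalgebra (PhiS M)) => [x|M].
  by apply: val_inj; exact: coordsE.
apply: functional_extensionality_dep => j.
by apply: Phi_inj; exact: coordsE.
Qed.

Section CenterField.
Variable R : nzRingType.

(** This alias of the center carries the proofs of regularity and primeness, on which its field
    structure depends. *)
Definition center_field of regular_ring R & prime_ring R : Type := center R.

Variables (reg : regular_ring R) (prm : prime_ring R).
Local Notation K := (center_field reg prm).

HB.instance Definition _ := GRing.ComNzRing.copy K (center R).

Lemma center_inv_exists (z : K) : exists w : K,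
  (z != 0 -> w * z = 1) /\ (z = 0 -> w = 0).
Proof.
have [->|z0] := eqVneq z 0; first by exists 0.
case: z z0 => z zZ z0; have /in_centerP zC := zZ.
have [|w wC wz] := prime_center_inv reg prm zC.
  by apply: contra_neq z0 => z0; exact: val_inj.
have wZ : w \in @in_center R by apply/in_centerP.
exists (Center wZ); split=> [_|zE]; first exact: val_inj.
by rewrite zE eqxx in z0.
Qed.

Definition center_inv (z : K) : K := sval (cid (center_inv_exists z)).

Lemma center_mulVf (z : K) : z != 0 -> center_inv z * z = 1.
Proof. exact: (svalP (cid (center_inv_exists z))).1. Qed.

Lemma center_invr0 : center_inv 0 = 0.
Proof. exact: (svalP (cid (center_inv_exists 0))).2. Qed.

HB.instance Definition _ :=
  GRing.ComNzRing_isField.Build K center_mulVf center_invr0.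
End CenterField.

Theorem theorem8p9 (F : realType) (R : nzRingType)
    (R_irreducible : irreducible_ring R)
    (R_continuous : continuous_ring R)
    (R_nondiscrete : nondiscrete_ring F R)
    (a : R) :
  algebraic_element (a : over_center R) <-> matricial_element (a : over_center R).
Proof.
split; last exact: matricial_algebraic.
case=> p p0 pa; case: R_continuous => reg cg.
have prm := continuous_prime reg R_irreducible cg.
have atl := nondiscrete_atomless reg prm R_nondiscrete.
have [rk rkP _] := R_nondiscrete.
have corner_scalar := corner_center prm atl (fun e => rank_simple reg prm cg rkP (e := e)).
pose K : fieldType := center_field reg prm.
pose iota : {rmorphism K -> R} := (\val : center R -> R).
have iotaC (k : K) x : iota k * x = x * iota k.
  by case: k => k kZ; exact: (in_centerP k kZ).
have iota_surj z : (forall x, z * x = x * z) -> exists k : K, iota k = z.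
  move=> zC; have zZ : z \in @in_center R by exact/in_centerP.
  by exists (Center zZ).
(* The two evaluations agree because [k%:A] in [over_center R] is [k * 1]. *)
have pa0 : horner_morph (eval_comm iotaC a) (p : {poly K}) * 1 = 0.
  rewrite mulr1 -[RHS]pa; congr (_.[a]).
  by apply: eq_map_poly => k; rewrite [RHS]mulr1.
have [I [n [E [c [mu aE]]]]] : matricial_on iota a 1.
  apply: (algebraic_matricial_on reg cg iota_surj corner_scalar _ _ _ pa0) => //.
  - by rewrite mulr1.
  - by rewrite mul1r mulr1.
apply: (@matrix_units_matricial (center R) (over_center R) I n E c).
- by case: (mu) => muM mu_sum mu_size mu_neq0; split.
(* A nonzero scalar is invertible in the field [K], so it cannot annihilate a nonzero unit. *)
- move=> i k kE; apply: contrapT => /eqP k0.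
  have := matrix_units_neq0 mu i.
  have kE' : iota k * E i 0%N 0%N = 0 := kE.
  rewrite -[E i _ _]mul1r -(rmorph1 iota) -(mulVf (k0 : (k : K) != 0)) rmorphM -mulrA.
  by rewrite kE' mulr0 eqxx.
- by rewrite -[LHS]mulr1 [LHS]aE.
Qed.
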